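(* Let $\{p_k/q_k\}\subset(0,1)$ be a sequence of even rational parameters converging to an irrational number. For each $k$ let $B_k$ be a block associated to $p_k/q_k$. Let $N$ be any fixed integer. Then for all sufficiently large $k$, both the number of distinct plaid polygons (for the parameter $p_k/q_k$) contained in $B_k$ and the maximum diameter of a plaid polygon contained in $B_k$ exceed $N$.
   Context: An even rational parameter is a rational $p/q\in(0,1)$, $p,q$ positive coprime integers, $pq$ even. Put $\omega=p+q$, $P=2p/\omega$, $Q=2q/\omega$. Line families: $\mathcal H$ = lines $y=n$, $\mathcal V$ = lines $x=n$ ($n\in\mathbb Z$), $\mathcal P$ = lines of slope $-P$ with integer $y$-intercept, $\mathcal Q$ = lines of slope $-Q$ with integer $y$-intercept. Functions mod $2\mathbb Z$, values represented in $(-1,1]$: $F_H=2Py$, $F_V=2Px$, $F_P=Py+P^2x+1$, $F_Q=Py+PQx+1$. A unit segment is an edge of a unit square of the integer grid; horizontal ones lie on $\mathcal H$-lines (set $A=H$), vertical ones on $\mathcal V$-lines (set $A=V$). A point $z$ of a unit segment $s$ is a light point of $s$ if for some $B\in\{P,Q\}$, $z$ lies on a line of $\mathcal B$, $F_A(z)F_B(z)>0$ and $|F_B(z)|<|F_A(z)|$. The light count of $s$ is the number of distinct light points of $s$, a light point that is the midpoint of a horizontal $s$ counted twice; $s$ is good if its light count is $1$. In each unit square draw the segments joining its center to the midpoints of its good edges; the plaid polygons are the connected components of the union of all these segments. Blocks: a block is a square $[0,\omega]^2+\ell$ with $\ell$ in the lattice generated by $(\omega^2,0)$ and $(0,\omega)$.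 *)

(* Defs.v *)
From HB Require Import structures.
From mathcomp Require Import all_boot all_order all_algebra.
From mathcomp Require Import all_classical all_reals all_analysis.
Import numFieldNormedType.Exports.
Set Implicit Arguments. Unset Strict Implicit. Unset Printing Implicit Defensive.
Import Order.TTheory GRing.Theory Num.Theory.
Local Open Scope classical_set_scope.
Local Open Scope ring_scope.

Section Plaid.
Variable R : realType.

Definition even_param (p q : nat) : Prop :=
  [/\ (0 < p)%N, (p < q)%N, coprime p q & ~~ odd (p * q)].

Definition omega (p q : nat) : R := (p + q)%:R.
Definition bigP (p q : nat) : R := 2 * p%:R / omega p q.
Definition bigQ (p q : nat) : R := 2 * q%:R / omega p q.

(* representative of x mod 2Z in (-1,1] *)
Definition mod2 (x : R) : R := x - 2 * (Num.ceil ((x - 1) / 2))%:~R.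

Definition F_H (p q : nat) (z : R * R) : R := mod2 (2 * bigP p q * z.2).
Definition F_V (p q : nat) (z : R * R) : R := mod2 (2 * bigP p q * z.1).
Definition F_P (p q : nat) (z : R * R) : R :=
  mod2 (bigP p q * z.2 + bigP p q ^+ 2 * z.1 + 1).
Definition F_Q (p q : nat) (z : R * R) : R :=
  mod2 (bigP p q * z.2 + bigP p q * bigQ p q * z.1 + 1).

Definition on_line (s : R) (z : R * R) : Prop :=
  exists c : int, z.2 + s * z.1 = c%:~R.

Inductive seg_kind := Hor | Ver.
Record unit_seg := USeg { skind : seg_kind; sm : int; sn : int }.

Definition in_seg (s : unit_seg) (z : R * R) : Prop :=
  match skind s with
  | Hor => z.2 = (sn s)%:~R /\ (sm s)%:~R <= z.1 <= (sm s)%:~R + 1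
  | Ver => z.1 = (sm s)%:~R /\ (sn s)%:~R <= z.2 <= (sn s)%:~R + 1
  end.

Definition seg_mid (s : unit_seg) : R * R :=
  match skind s with
  | Hor => ((sm s)%:~R + 2^-1, (sn s)%:~R)
  | Ver => ((sm s)%:~R, (sn s)%:~R + 2^-1)
  end.

Definition F_A (p q : nat) (s : unit_seg) : R * R -> R :=
  match skind s with Hor => F_H p q | Ver => F_V p q end.

Definition light_point (p q : nat) (s : unit_seg) (z : R * R) : Prop :=
  in_seg s z /\
  ((on_line (bigP p q) z /\ 0 < F_A p q s z * F_P p q z /\
      `|F_P p q z| < `|F_A p q s z|) \/
   (on_line (bigQ p q) z /\ 0 < F_A p q s z * F_Q p q z /\
      `|F_Q p q z| < `|F_A p q s z|)).

(* light count = 1: exactly one light point, and (since the midpoint of a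
   horizontal segment is counted twice) it is not the midpoint of a
   horizontal segment *)
Definition good (p q : nat) (s : unit_seg) : Prop :=
  exists z, light_point p q s z /\ (forall w, light_point p q s w -> w = z) /\
    (skind s = Hor -> z <> seg_mid s).

Definition segment (a b : R * R) : set (R * R) :=
  [set z | exists t : R, 0 <= t <= 1 /\
     z = (a.1 + t * (b.1 - a.1), a.2 + t * (b.2 - a.2))].

Definition square_edge (m n : int) (s : unit_seg) : Prop :=
  s = USeg Hor m n \/ s = USeg Hor m (n + 1) \/
  s = USeg Ver m n \/ s = USeg Ver (m + 1) n.

Definition sq_center (m n : int) : R * R := (m%:~R + 2^-1, n%:~R + 2^-1).

Definition plaid_union (p q : nat) : set (R * R) :=
  [set z | exists (m n : int) (s : unit_seg),
     square_edge m n s /\ good p q s /\ segment (sq_center m n) (seg_mid s) z].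

Definition plaid_polygon (p q : nat) (C : set (R * R)) : Prop :=
  exists x, plaid_union p q x /\ C = @connected_component (R * R)%type (plaid_union p q) x.

Definition block (p q : nat) (a b : int) : set (R * R) :=
  [set z | a%:~R * omega p q ^+ 2 <= z.1 <= a%:~R * omega p q ^+ 2 + omega p q /\
           b%:~R * omega p q <= z.2 <= b%:~R * omega p q + omega p q].

Definition dist2 (z w : R * R) : R :=
  Num.sqrt ((z.1 - w.1) ^+ 2 + (z.2 - w.2) ^+ 2).

End Plaid.

(* Main.v *)
(* Idea.  Whether the line of slope -P or -Q with intercept c is light where it
   crosses a grid line depends only on c and on that grid line, and its parity is a
   sum of terms of the form floor(x / 2).  In a unit square these terms cancel in
   pairs, so every square has an even number of good edges.

   Diameter: the block has a line [x = m] of capacity 2 with [m < w / 2].  Its only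
   two good edges lie symmetrically about the horizontal midline, and by parity they
   are joined to each other on the left of that line.

   Number: the grid lines of capacity at most 2K cut the block into (2K + 1)^2
   rectangles and carry at most 4K(K + 1) good edges in all.  By parity some
   rectangle is crossed by no polygon.  Letting K be proportional to w, with smaller
   and smaller factors, gives uncrossed rectangles at arbitrarily many scales, whose
   sizes are bounded as k grows because the limit is irrational.  Good edges are
   relatively dense, so each rectangle contains a good edge lying far from the
   polygons found at the smaller scales, hence a new polygon. *)
Require Import Defs.
From HB Require Import structures.
From mathcomp Require Import all_boot all_order all_algebra.
From mathcomp Require Import all_classical all_reals all_analysis.
From mathcomp Require Import ring lra zify.
Import Order.TTheory GRing.Theory Num.Theory numFieldNormedType.Exports.
Local Open Scope classical_set_scope.
Local Open Scope ring_scope.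

Set Implicit Arguments.
Unset Strict Implicit.
Unset Printing Implicit Defensive.

(** * Points of the circle R / 2Z *)

(** What makes the parity argument exact is that [w] is odd: [P c + 1] is then never an even
    integer, so no comparison of values is ever an equality and each floor changes parity under a
    change of sign. Coincidences of light points occur only where the two lines involved are light
    together, and counting midpoints of horizontal edges twice compensates for exactly these. The
    obstacle in counting polygons is uniformity: a rectangle exists for each parameter separately,
    but its size must be bounded before [p] and [q] are known. Every constant is therefore computed
    at the irrational limit [P0] of the slopes with some margin, and the margin is spent on
    replacing [P0] by a nearby [P]. Polygons are then collected by induction on their number. Of the
    earlier ones only a bound on their horizontal extent is kept, which is enough to find a strip of
    the next rectangle that they avoid. *)

Definition oddz (z : int) : bool := odd `|z|%N.

Lemma oddzD (x y : int) : oddz (x + y) = oddz x (+) oddz y.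
Proof. rewrite /oddz; lia. Qed.

Lemma oddzN (x : int) : oddz (- x) = oddz x.
Proof. by rewrite /oddz abszN. Qed.

Section Circle.
Variable R : realType.
Implicit Types x y v : R.

Lemma mod2E x : exists k : int, x = mod2 x + 2 * k%:~R.
Proof. by exists (Num.ceil ((x - 1) / 2)); rewrite /mod2 subrK. Qed.

Lemma mod2_itv x : -1 < mod2 x <= 1.
Proof.
rewrite /mod2; have /andP[] := ceil_itv ((x - 1) / 2).
by rewrite intrD; lra.
Qed.

Lemma int_near (y z : int) : `|y%:~R - z%:~R| < 1 :> R -> y = z.
Proof. by rewrite -intrB -intr_norm (ltr_int R _ 1); lia. Qed.

Lemma mod2_unique x v (k : int) : -1 < v <= 1 -> x = v + 2 * k%:~R -> mod2 x = v.
Proof.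
move=> hv hx; have [j hj] := mod2E x; have hm := mod2_itv x.
have ejk : j = k.
  by apply: int_near; rewrite ltr_norml; apply/andP; split; lra.
by move: hj hx; rewrite ejk; lra.
Qed.

Lemma mod2D x (k : int) : mod2 (x + 2 * k%:~R) = mod2 x.
Proof.
have [j hj] := mod2E x.
apply: (@mod2_unique _ _ (j + k)); first exact: mod2_itv.
by rewrite intrD {1}hj; ring.
Qed.

(* parity of the number of even integers met when going from [0+] to [x] *)
Definition half_parity x : bool := oddz (Num.floor (x / 2)).

Lemma half_parityD x (k : int) :
  half_parity (x + 2 * k%:~R) = half_parity x (+) oddz k.
Proof.
rewrite /half_parity -oddzD; congr oddz.
apply: floor_def; rewrite !intrD.
have /andP[] := floor_itv (x / 2); rewrite intrD; lra.
Qed.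

Lemma half_parityN x : (forall k : int, x <> 2 * k%:~R) ->
  half_parity (- x) = ~~ half_parity x.
Proof.
move=> hx; rewrite /half_parity.
suff -> : Num.floor (- x / 2) = - Num.floor (x / 2) - 1.
  by rewrite oddzD !oddzN addbT.
apply: floor_def; have /andP[h1 h2] := floor_itv (x / 2).
have h3 := hx (Num.floor (x / 2)).
have h4 : (Num.floor (x / 2))%:~R != x / 2 :> R.
  by apply/eqP => e; apply: h3; rewrite e; lra.
have {h4 h1} h1 : (Num.floor (x / 2))%:~R < x / 2 :> R by rewrite lt_neqAle h4.
by move: h2; rewrite !intrD !intrN; lra.
Qed.

Lemma half_parity_small x : -2 <= x < 2 -> half_parity x = (x < 0).
Proof.
move=> hx; rewrite /half_parity; case: ltP => h.
  by rewrite (@floor_def _ _ (-1)) //; rewrite !intrD !intrN; lra.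
by rewrite (@floor_def _ _ 0) //; rewrite !intrD; lra.
Qed.

(* With [g = mod2 x] and [f = mod2 y], and provided [f] differs from [0] and [g],
   [f] lies between [0] and [g] iff exactly one of [g < f] and [0 < f] holds. *)
Definition between x y : bool := (mod2 x < mod2 y) (+) (0 < mod2 y).

(** The bit [b] depends on [x] only, so two lines meeting the same grid line share it and it cancels
    in the parity of an edge. It is the parity of the integer [k] with [x = mod2 x + 2 k]; the
    corresponding integer of [y] enters twice. *)
Lemma between_parity x : exists b, forall y,
  between x y = half_parity (x - y) (+) half_parity (- y) (+) b.
Proof.
have [k hk] := mod2E x; exists (oddz k) => y; have [j hj] := mod2E y.
have := mod2_itv x; have := mod2_itv y => hy hx.
have -> : x - y = (mod2 x - mod2 y) + 2 * (k - j)%:~R.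
  by rewrite intrB {1}hk {1}hj; ring.
have -> : - y = - mod2 y + 2 * (- j)%:~R by rewrite intrN {1}hj; ring.
rewrite !half_parityD !half_parity_small; [|lra|lra].
rewrite oddzD !oddzN /between subr_lt0 oppr_lt0.
by case: (_ < _); case: (_ < _); case: (oddz k); case: (oddz j).
Qed.

Lemma betweenP x y : mod2 y != 0 -> mod2 y != mod2 x ->
  between x y <-> (0 < mod2 x * mod2 y /\ `|mod2 y| < `|mod2 x|).
Proof.
move=> y0 yx; rewrite /between.
set f := mod2 y; set g := mod2 x.
have yx' : g != f by rewrite eq_sym.
have [f0|f0|f0] := ltgtP f 0; last by move: y0; rewrite -/f f0 eqxx.
- rewrite addbF; split => [gf|].
    have g0 : g < 0 by apply: lt_trans f0.
    by split; [rewrite nmulr_lgt0 | rewrite !ltr0_norm // ltrN2].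
  by case; rewrite nmulr_lgt0 // => g0; rewrite !ltr0_norm // ltrN2.
- rewrite addbT -leNgt; split => [fg|].
    have g0 : 0 < g by apply: lt_le_trans fg.
    split; first by rewrite pmulr_lgt0.
    by rewrite !gtr0_norm // lt_neqAle fg eq_sym yx'.
  by case; rewrite pmulr_lgt0 // => g0; rewrite !gtr0_norm // => /ltW.
Qed.

End Circle.

(** * Light lines and parity *)

Section Lines.
Variables (R : realType) (p q : nat).
Hypothesis pq : even_param p q.
Notation w := (p + q)%N.
Notation P := (bigP R p q).
Notation Q := (bigQ R p q).

Lemma even_paramP : [/\ (0 < p)%N, (p < q)%N, coprime p w, odd w & (2 < w)%N].
Proof.
have [p0 pq' cop ev] := pq; split=> //; last by lia.
  by rewrite /coprime gcdnDl.
rewrite oddD; move: ev; rewrite oddM; case po: (odd p); case qo: (odd q) => //= _.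
have : (2 %| gcdn p q)%N by rewrite dvdn_gcd !dvdn2 po qo.
by rewrite (eqP cop).
Qed.

Lemma w_gt0 : 0 < w%:R :> R.
Proof. by have [_ _ _ _ h] := even_paramP; rewrite ltr0n; lia. Qed.

Lemma bigPw : P * w%:R = 2 * p%:R.
Proof. by rewrite /bigP /omega divfK // gt_eqF // w_gt0. Qed.

Lemma bigQE : Q = 2 - P.
Proof.
have := w_gt0; rewrite /bigP /bigQ /omega natrD => h.
by field; rewrite gt_eqF.
Qed.

Lemma bigP_itv : 0 < P < 1.
Proof.
have [p0 ltpq _ _ _] := even_paramP; have h := w_gt0.
rewrite /bigP /omega; apply/andP; split;
  first by apply: divr_gt0 => //; apply: mulr_gt0; rewrite ?ltr0n.
by rewrite ltr_pdivrMr // mul1r -natrM ltr_nat; lia.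
Qed.

Lemma bigP_int (c k : int) : P * c%:~R = k%:~R -> 2 * p%:Z * c = k * w%:Z.
Proof.
move=> h; apply: (@intr_inj R); rewrite !intrM /=.
have -> : p%:Z%:~R = p%:R :> R by [].
by have -> : w%:Z%:~R = w%:R :> R; [|rewrite -h -bigPw; ring].
Qed.

Lemma dvd_w (c : int) : (w%:Z %| 2 * p%:Z * c)%Z -> (w%:Z %| c)%Z.
Proof.
have [_ _ cop od _] := even_paramP.
rewrite -mulrA Gauss_dvdzr; last by rewrite coprimezE /= coprime_sym coprime2n.
by rewrite Gauss_dvdzr // coprimezE /= coprime_sym.
Qed.

Lemma bigP_intP (c k : int) : P * c%:~R = k%:~R -> (w%:Z %| c)%Z.
Proof. by move/bigP_int => h; apply: dvd_w; rewrite h dvdz_mull. Qed.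

Lemma bigP_shift (c z : int) :
  P * (c + w%:Z * z)%:~R = P * c%:~R + 2 * (p%:Z * z)%:~R.
Proof.
rewrite intrD !intrM -!pmulrn mulrDr; congr (_ + _).
by rewrite !mulrA bigPw.
Qed.

(** Otherwise [2 p c = (2 k - 1) w], an even number equal to an odd one. This excludes the
    degenerate cases of [betweenP] and [half_parityN]. *)
Lemma bigP_odd (c k : int) : P * c%:~R + 1 <> 2 * k%:~R.
Proof.
move=> h; have : P * c%:~R = (2 * k - 1)%:~R by rewrite intrB intrM; lra.
move/bigP_int; have [_ _ _ od _] := even_paramP.
lia.
Qed.

(* [lit i c]: a line of slope -P or -Q with intercept [c] has a light point where
   it meets the i-th grid line, horizontal or vertical. *)
Definition lit (i c : int) : bool := between (2 * P * i%:~R) (P * c%:~R + 1).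

Lemma litP (i c : int) : lit i c <->
  0 < mod2 (2 * P * i%:~R) * mod2 (P * c%:~R + 1) /\
  `|mod2 (P * c%:~R + 1)| < `|mod2 (2 * P * i%:~R)|.
Proof.
apply: betweenP; apply/eqP.
  have [k hk] := mod2E (P * c%:~R + 1) => h0.
  by apply: (@bigP_odd c k); rewrite hk h0 add0r.
have [k hk] := mod2E (P * c%:~R + 1); have [j hj] := mod2E (2 * P * i%:~R) => h0.
apply: (@bigP_odd (c - 2 * i) (k - j)).
rewrite !intrB intrM; move: hk hj; rewrite h0; lra.
Qed.

Lemma lit_shift (i c y z : int) : lit (i + w%:Z * y) (c + w%:Z * z) = lit i c.
Proof.
rewrite /lit /between -mulrA !bigP_shift mulrDr.
have -> : forall u v : R, u + 2 * v + 1 = u + 1 + 2 * v by move=> u v; ring.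
by rewrite -(intrM _ 2) !mod2D mulrA.
Qed.

(** On these grid lines [F_H] or [F_V] vanishes, so no value has smaller modulus. This is what
    separates the blocks from each other. *)
Lemma lit0 (i c : int) : (w%:Z %| i)%Z -> lit i c = false.
Proof.
move=> /dvdzP[z ->]; rewrite mulrC -[_ * z]add0r -(addr0 c).
rewrite -{2}(mulr0 w%:Z) lit_shift /lit /between mulr0.
have -> : mod2 0 = 0 :> R; last by rewrite addbb.
by apply: (@mod2_unique _ _ _ 0); [lra|rewrite mulr0 addr0].
Qed.

(* Reflecting the intercept about [i] exchanges [F] and [G - F]. *)
Lemma lit_sym (i c d : int) : (w%:Z %| c + d - 2 * i)%Z -> lit i c = lit i d.
Proof.
move=> /dvdzP[z hz].
have -> : d = (2 * i - c) + w%:Z * z by lia.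
have := lit_shift i (2 * i - c) 0 z; rewrite mulr0 addr0 => ->; rewrite /lit.
have [b hb] := between_parity (2 * P * i%:~R); rewrite !hb.
set F := P * c%:~R + 1.
have eF : P * (2 * i - c)%:~R + 1 = 2 * P * i%:~R - F + 2.
  by rewrite /F intrB intrM; ring.
have -> : 2 * P * i%:~R - (P * (2 * i - c)%:~R + 1) = F + 2 * (-1)%:~R.
  by rewrite eF intrN; ring.
have -> : - (P * (2 * i - c)%:~R + 1) = - (2 * P * i%:~R - F) + 2 * (-1)%:~R.
  by rewrite eF intrN; ring.
rewrite !half_parityD !half_parityN; first last.
- exact: bigP_odd.
- move=> k hk; apply: (@bigP_odd (c - 2 * i) (-k)).
  by rewrite intrB intrN intrM; move: hk; rewrite /F; lra.
by do 2!case: (half_parity _); case: (b).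
Qed.

(* In the unit square with lower left corner [(m, n)], [n + top m] is the
   intercept of the P-line entering through the left edge. *)
Definition top (m : int) : int := Num.floor (P * m%:~R) + 1.

Lemma top_itv (m : int) : (top m)%:~R - 1 <= P * m%:~R < (top m)%:~R.
Proof.
by rewrite /top; have := floor_itv (P * m%:~R); rewrite intrD; lra.
Qed.

Lemma top_unique (m k : int) : k%:~R - 1 <= P * m%:~R < k%:~R -> top m = k.
Proof.
move=> h; have h' := top_itv m.
by apply: (@int_near R); rewrite ltr_norml; apply/andP; split; lra.
Qed.

Lemma top_step (m : int) : top (m + 1) = top m \/ top (m + 1) = top m + 1.
Proof.
have h := top_itv m; have hP := bigP_itv.
case: (ltP (P * (m + 1)%:~R) (top m)%:~R) => h1.
  left; apply: top_unique; move: h h1; rewrite intrD mulrDr; lra.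
right; apply: top_unique; move: h h1; move: (top m) => k.
by rewrite !intrD mulrDr; lra.
Qed.

Lemma top_shift (m z : int) : top (m + w%:Z * z) = top m + 2 * (p%:Z * z).
Proof.
apply: top_unique; rewrite bigP_shift; have := top_itv m.
by move: (top m) => k; rewrite !intrD (intrM _ 2); lra.
Qed.

(* With [h = top m - P m], the P-line through the left edge leaves the square
   through the bottom edge iff [h <= P], that is, iff [top (m + 1) = top m + 1].
   Then each edge meets one P-line and one Q-line; otherwise horizontal edges
   meet two Q-lines instead. *)
Definition vgood (m n : int) : bool :=
  lit m (n + top m) (+) lit m (n + 2 * m + 1 - top m).

Definition hgood (m n : int) : bool :=
  lit n (n + 2 * m + 1 - top m) (+)
  (if top (m + 1) == top m + 1 then lit n (n + top m)
   else lit n (n + 2 * m + 2 - top m)).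

(** Moving [m] by [w] moves [top m] by [2 p], which is not a multiple of [w]; hence the horizontal
    period [w ^ 2] of the lattice of blocks. *)
Lemma vgood_shift (m n y z : int) :
  vgood (m + w%:Z * (w%:Z * y)) (n + w%:Z * z) = vgood m n.
Proof.
rewrite /vgood top_shift; congr (_ (+) _).
  have -> : n + w%:Z * z + (top m + 2 * (p%:Z * (w%:Z * y))) =
    n + top m + w%:Z * (z + 2 * (p%:Z * y)) by ring.
  by rewrite lit_shift.
have -> : n + w%:Z * z + 2 * (m + w%:Z * (w%:Z * y)) + 1 -
    (top m + 2 * (p%:Z * (w%:Z * y))) =
  n + 2 * m + 1 - top m + w%:Z * (z + 2 * (w%:Z * y) - 2 * (p%:Z * y)) by ring.
by rewrite lit_shift.
Qed.

Lemma hgood_shift (m n y z : int) :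
  hgood (m + w%:Z * (w%:Z * y)) (n + w%:Z * z) = hgood m n.
Proof.
rewrite /hgood [m + _ + 1]addrAC !top_shift.
have -> : (top (m + 1) + 2 * (p%:Z * (w%:Z * y)) ==
    top m + 2 * (p%:Z * (w%:Z * y)) + 1) = (top (m + 1) == top m + 1).
  by rewrite -[RHS](inj_eq (addIr (2 * (p%:Z * (w%:Z * y))))) [X in _ == X]addrAC.
have e (d : int) :
  n + w%:Z * z + 2 * (m + w%:Z * (w%:Z * y)) + d -
    (top m + 2 * (p%:Z * (w%:Z * y))) =
  n + 2 * m + d - top m + w%:Z * (z + 2 * (w%:Z * y) - 2 * (p%:Z * y)) by ring.
rewrite !e !lit_shift.
have -> : n + w%:Z * z + (top m + 2 * (p%:Z * (w%:Z * y))) =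
    n + top m + w%:Z * (z + 2 * (p%:Z * y)) by ring.
by rewrite !lit_shift.
Qed.

(* Every line crossing the square contributes [half_parity (G - F)] for the two
   edges it meets, and the central symmetry of the square pairs these terms. *)
Lemma square_even (m n : int) :
  vgood m n (+) vgood (m + 1) n (+) hgood m n (+) hgood m (n + 1) = false.
Proof.
have pair (i j c d : int) : c + d = 2 * i + 2 * j ->
    half_parity (2 * P * i%:~R - (P * c%:~R + 1)) =
    half_parity (2 * P * j%:~R - (P * d%:~R + 1)).
  move=> e.
  have -> : d = 2 * i + 2 * j - c by rewrite -e; ring.
  have -> : 2 * P * j%:~R - (P * (2 * i + 2 * j - c)%:~R + 1) =
      - (2 * P * i%:~R - (P * c%:~R + 1)) + 2 * (-1)%:~R.
    by rewrite intrB intrD intrN !intrM; ring.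
  rewrite half_parityD half_parityN; first by rewrite addbT negbK.
  move=> k hk; apply: (@bigP_odd (c - 2 * i) (-k)).
  by rewrite intrB intrN intrM; move: hk; lra.
have same (i j c d : int) : c + 2 * j = d + 2 * i ->
    half_parity (2 * P * i%:~R - (P * c%:~R + 1)) =
    half_parity (2 * P * j%:~R - (P * d%:~R + 1)).
  move=> e; have -> : c = d + 2 * i - 2 * j by rewrite -e; ring.
  congr half_parity; rewrite intrB intrD !intrM; ring.
have cancel (x y f g b : bool) :
  (x (+) f (+) b) (+) (y (+) g (+) b) = (x (+) y) (+) (f (+) g).
  by case: x; case: y; case: f; case: g; case: b.
have [b1 h1] := between_parity (2 * P * m%:~R).
have [b2 h2] := between_parity (2 * P * (m + 1)%:~R).
have [b3 h3] := between_parity (2 * P * n%:~R).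
have [b4 h4] := between_parity (2 * P * (n + 1)%:~R).
rewrite /vgood /hgood /lit; set a := top m.
(* In both cases four lines cross the square and each meets two edges, so the terms
   [half_parity (- F)] occur twice. The bits [b1] to [b4] occur twice as well, and [pair] and [same]
   match the remaining eight terms. *)
have [->|->] := top_step m; rewrite -/a.
  have -> : (a == a + 1) = false by apply/eqP; lia.
  rewrite !h1 !h2 !h3 !h4.
  have -> : n + 2 * (m + 1) + 1 - a = n + 2 * m + 3 - a by ring.
  have -> : n + 1 + 2 * m + 1 - a = n + 2 * m + 2 - a by ring.
  have -> : n + 1 + 2 * m + 2 - a = n + 2 * m + 3 - a by ring.
  rewrite (@pair m (n + 1) (n + a) (n + 2 * m + 2 - a)); last by ring.
  rewrite (@pair (m + 1) n (n + a) (n + 2 * m + 2 - a)); last by ring.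
  rewrite (@same m (m + 1) (n + 2 * m + 1 - a) (n + 2 * m + 3 - a)); last by ring.
  rewrite (@same n (n + 1) (n + 2 * m + 1 - a) (n + 2 * m + 3 - a)); last by ring.
  rewrite !cancel; clear; do !move: (half_parity _); clear.
by do !case.
rewrite eqxx.
have -> : n + 2 * (m + 1) + 1 - (a + 1) = n + 2 * m + 2 - a by ring.
have -> : n + 1 + 2 * m + 1 - a = n + 2 * m + 2 - a by ring.
have -> : n + (a + 1) = n + 1 + a by ring.
rewrite !h1 !h2 !h3 !h4.
rewrite (@pair m (n + 1) (n + a) (n + 2 * m + 2 - a)); last by ring.
rewrite (@pair m (n + 1) (n + 2 * m + 1 - a) (n + 1 + a)); last by ring.
rewrite (@pair n (m + 1) (n + a) (n + 2 * m + 2 - a)); last by ring.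
rewrite (@pair n (m + 1) (n + 2 * m + 1 - a) (n + 1 + a)); last by ring.
rewrite !cancel; clear; do !move: (half_parity _); clear.
by do !case.
Qed.

End Lines.

(** * Good edges *)

(** Here [z1] and [z2] are the crossings of an edge with its two lines and [bad] singles out the
    point counted twice. The crossings may coincide only there, and if one of them is there then
    both lines are light or both dark, so a light count of one is the same as an exclusive or. *)
Lemma unique_xor (T : Type) (L bad : T -> Prop) (z1 z2 : T) (l1 l2 : bool) :
  (forall z, L z <-> l1 /\ z = z1 \/ l2 /\ z = z2) ->
  (z1 = z2 -> bad z1) -> (bad z1 -> l1 = l2) -> (bad z2 -> l1 = l2) ->
  (exists z, L z /\ (forall w, L w -> w = z) /\ ~ bad z) <-> l1 (+) l2.
Proof.
move=> hL h12 b1 b2; split=> [[z [Lz [uz nb]]]|].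
  case e1: l1; case e2: l2 => //.
    have h1 : z1 = z by apply: uz; apply/hL; left.
    have h2 : z2 = z by apply: uz; apply/hL; right.
    by case: nb; rewrite -h1; apply: h12; rewrite h2.
  by case/hL: Lz => -[]; rewrite ?e1 ?e2.
case e1: l1; case e2: l2 => // _.
  exists z1; split; first by apply/hL; left.
  split=> [v /hL[[_ ->] //|[]]|/b1]; by rewrite ?e1 ?e2.
exists z2; split; first by apply/hL; right.
split=> [v /hL[[]|[_ ->] //]|/b2]; by rewrite ?e1 ?e2.
Qed.

Section Good.
Variables (R : realType) (p q : nat).
Hypothesis pq : even_param p q.
Notation w := (p + q)%N.
Notation P := (bigP R p q).
Notation Q := (bigQ R p q).
Notation lit := (@lit R p q).
Notation top := (top R p q).
Notation vgood := (vgood R p q).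
Notation hgood := (hgood R p q).

Definition seg_line (s : unit_seg) : int :=
  match skind s with Hor => sn s | Ver => sm s end.

(** The factorizations [F_P = P (y + P x) + 1] and [F_Q = P (y + Q x) + 1] turn both functions into
    [P c + 1] on a line of intercept [c]. *)
Lemma light_pointE (s : unit_seg) (z : R * R) :
  light_point p q s z <-> in_seg s z /\ exists c : int,
    (z.2 + P * z.1 = c%:~R \/ z.2 + Q * z.1 = c%:~R) /\ lit (seg_line s) c.
Proof.
have FA : in_seg s z -> F_A p q s z = mod2 (2 * P * (seg_line s)%:~R).
  by case: s => -[] m n; rewrite /in_seg /F_A /= => -[h _]; rewrite /F_H /F_V h.
have FP c : z.2 + P * z.1 = c%:~R -> F_P p q z = mod2 (P * c%:~R + 1).
  by move=> <-; congr mod2; ring.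
have FQ c : z.2 + Q * z.1 = c%:~R -> F_Q p q z = mod2 (P * c%:~R + 1).
  by move=> <-; congr mod2; ring.
split=> [[hs] | [hs [c [hc /(litP R pq)]]]].
  case=> -[[c hc]]; rewrite FA //.
    rewrite (FP _ hc) => h; split=> //; exists c; split; first by left.
    exact/(litP R pq).
  rewrite (FQ _ hc) => h; split=> //; exists c; split; first by right.
  exact/(litP R pq).
split=> //; case: hc => hc; [left|right]; rewrite FA // ?(FP _ hc) ?(FQ _ hc);
  by split=> //; exists c.
Qed.

Lemma good_vgood (m n : int) : good R p q (USeg Ver m n) <-> vgood m n.
Proof.
have hQ := bigQE R pq; have [P0 P1] := andP (bigP_itv R pq).
(* If [w] divides [m] then [P m] and [Q m] are integers and lines pass through both ends of the
   edge, so there are more than two candidates; but none of them is lit. *)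
have [dm|ndm] := boolP (w%:Z %| m)%Z.
  split=> [[z [/light_pointE[_ [c [_]]]]]|].
    by rewrite lit0.
  by rewrite /vgood !lit0.
have ha := top_itv R p q m; rewrite /vgood.
move: (top m) ha => a ha.
have Pm : (a%:~R - 1 < P * m%:~R < a%:~R).
  have /andP[h1 ->] := ha; rewrite andbT lt_neqAle h1 andbT.
  apply: contra ndm => /eqP e.
  by apply: (@bigP_intP R p q pq m (a - 1)); rewrite intrB e.
(* Equality would mean that the P-line and the Q-line cross on the edge. *)
have half : 2 * (P * m%:~R) <> 2 * a%:~R - 1.
  move=> e; apply: (bigP_odd pq (c := -2 * m) (k := 1 - a)).
  by rewrite !intrM intrB intrN; move: e; lra.
apply: iff_trans (unique_xor (L := light_point p q (USeg Ver m n))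
  (bad := fun z => Ver = Hor /\ z = seg_mid R (USeg Ver m n))
  (z1 := (m%:~R, n%:~R + a%:~R - P * m%:~R))
  (z2 := (m%:~R, n%:~R + 2 * m%:~R + 1 - a%:~R - Q * m%:~R)) _ _ _ _).
- split=> -[z [h1 [h2 h3]]]; exists z; split=> //; split=> //.
    by case.
- move=> [x y]; apply: iff_trans (light_pointE _ _) _; rewrite /in_seg /=.
  split.
    case=> -[-> hy] [c [hc lc]]; case: hc => hc; [left|right].
      have e : c = n + a.
        by apply: (@int_near R); rewrite -hc intrD ltr_norml; lra.
      split; first by rewrite -e.
      by congr pair; move: hc; rewrite e intrD; lra.
    have e : c = n + 2 * m + 1 - a.
      apply: (@int_near R); rewrite -hc intrB !intrD intrM hQ ltr_norml; lra.
    split; first by rewrite -e.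
    by congr pair; move: hc; rewrite e intrB !intrD intrM; lra.
  case=> -[l [-> ->]].
    split; first by split=> //; lra.
    exists (n + a); split=> //; left; rewrite intrD; lra.
  split; first by split=> //; rewrite hQ; lra.
  exists (n + 2 * m + 1 - a); split=> //; right.
  by rewrite intrB !intrD intrM; lra.
- by case=> h; case: half; move: h; rewrite hQ; lra.
- by case.
- by case.
Qed.

Lemma good_hgood (m n : int) : good R p q (USeg Hor m n) <-> hgood m n.
Proof.
have hQ := bigQE R pq; have [P0 P1] := andP (bigP_itv R pq).
have ha := top_itv R p q m; have ha1 := top_itv R p q (m + 1).
have hstep := top_step R pq m; rewrite /hgood.
move: (top m) (top (m + 1)) ha ha1 hstep => a a1 ha ha1 hstep.
have Qpos : 0 < Q by rewrite hQ; lra.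
have Q0 : Q != 0 by rewrite gt_eqF.
have P00 : P != 0 by lra.
have [x1 hx1] : exists x1 : R, Q * x1 = 2 * m%:~R + 1 - a%:~R.
  by exists ((2 * m%:~R + 1 - a%:~R) / Q); rewrite mulrC divfK.
have eqQ (x y : R) : Q * x = Q * y -> x = y by apply: mulfI.
have eqP' (x y : R) : P * x = P * y -> x = y by apply: mulfI.
(* When the P-line passes through the midpoint, [w] divides [2 m + 1], and the intercepts of the
   P-line and the Q-line are symmetric about [n] modulo [w]. *)
have mid : P * (m%:~R + 2^-1) = a%:~R ->
    lit n (n + 2 * m + 1 - a) = lit n (n + a).
  move=> h; apply: (lit_sym R pq).
  have -> : n + 2 * m + 1 - a + (n + a) - 2 * n = 2 * m + 1 by ring.
  apply: (@bigP_intP R p q pq _ (2 * a)).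
  by rewrite intrD !intrM -h; field.
set b := _ == _.
have hb : if b then a%:~R <= P * (m%:~R + 1) else P * (m%:~R + 1) < a%:~R.
  move: ha1; rewrite /b intrD; have [->|->] := hstep.
    have -> : (a == a + 1) = false by clear; apply/eqP; lia.
    by case/andP.
  by rewrite eqxx intrD; case/andP; lra.
clearbody b.
have [x2 hx2] : exists x2 : R,
    if b then P * x2 = a%:~R else Q * x2 = 2 * m%:~R + 2 - a%:~R.
  case: (b); first by exists (a%:~R / P); rewrite mulrC divfK.
  by exists ((2 * m%:~R + 2 - a%:~R) / Q); rewrite mulrC divfK.
apply: iff_trans (unique_xor (L := light_point p q (USeg Hor m n))
  (bad := fun z => Hor = Hor /\ z = seg_mid R (USeg Hor m n))
  (z1 := (x1, n%:~R)) (z2 := (x2, n%:~R))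
  (l2 := if b then lit n (n + a) else lit n (n + 2 * m + 2 - a)) _ _ _ _).
- split=> -[z [h1 [h2 h3]]]; exists z; split=> //; split=> //.
    by case=> _; apply: h3.
  by move=> _ h; apply: h3.
- move=> [x y]; apply: iff_trans (light_pointE _ _) _; rewrite /in_seg /=.
  split.
    case=> -[-> hx] [c [hc lc]]; case: hc => hc.
      have hPx : P * m%:~R <= P * x <= P * (m%:~R + 1) by rewrite !ler_pM2l.
      have [e|e] : c = n + a \/ c = n + a - 1.
        have l1 : c < n + a + 1.
          by rewrite -(ltr_int R) -hc !intrD; move: hPx; lra.
        have l2 : n + a - 1 <= c.
          by rewrite -(ler_int R) -hc intrB !intrD; move: hPx; lra.
        clear -l1 l2; lia.
        right; move: hb hx2; rewrite -e; case: b => hb hx2.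
          by split=> //; congr pair; apply: eqP'; move: hc; rewrite e intrD; lra.
        by exfalso; move: hc; rewrite e intrD; move: hPx; lra.
      (* This additional P-line passes through the left corner. There [w] divides [m], and the
         P-line shares both the point and its lightness with the Q-line of the first candidate. *)
      have hm : P * m%:~R = (a - 1)%:~R.
        by move: hc hPx; rewrite e !intrB !intrD; lra.
      have dm := bigP_intP pq hm.
      left; split.
        rewrite -(lit_sym R pq (c := c)) // e.
        have -> : n + a - 1 + (n + 2 * m + 1 - a) - 2 * n = m * 2 by ring.
        exact: dvdz_mulr.
      congr pair; apply: eqQ; rewrite hx1.
      have : P * x = P * m%:~R.
        by move: hc hm; rewrite e !intrB !intrD; lra.
      by move=> /eqP' ->; move: hm; rewrite hQ intrB; lra.
    have hPx : P * m%:~R <= P * x <= P * (m%:~R + 1) by rewrite !ler_pM2l.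
    have hQx : Q * m%:~R <= Q * x <= Q * (m%:~R + 1).
      by rewrite !ler_pM2l // hQ; lra.
    have [e|e] : c = n + 2 * m + 1 - a \/ c = n + 2 * m + 2 - a.
      have l1 : c < n + 2 * m + 3 - a.
        by rewrite -(ltr_int R) -hc intrB !intrD intrM; move: hQx; rewrite hQ; lra.
      have l2 : n + 2 * m - a < c.
        by rewrite -(ltr_int R) -hc intrB !intrD intrM; move: hQx; rewrite hQ; lra.
      clear -l1 l2; lia.
      left; rewrite -e; split=> //; congr pair; apply: eqQ.
      by move: hc; rewrite e intrB !intrD intrM hx1; lra.
    have hQx2 : Q * x = 2 * m%:~R + 2 - a%:~R.
      by move: hc; rewrite e intrB !intrD intrM; lra.
    right; move: hb hx2; case: b => hb hx2.
      (* The same at the right corner: the additional Q-line is absorbed by the P-line of the second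
         candidate. *)
      have hm : P * (m + 1)%:~R = a%:~R.
        by rewrite intrD; move: hQx; rewrite hQx2 hQ; lra.
      have dm := bigP_intP pq hm.
      split.
        rewrite -(lit_sym R pq (c := c)) // e.
        have -> : n + 2 * m + 2 - a + (n + a) - 2 * n = (m + 1) * 2 by ring.
        exact: dvdz_mulr.
      have ex : x = m%:~R + 1.
        by apply: eqQ; rewrite hQx2; move: hm; rewrite hQ intrD; lra.
      by congr pair; apply: eqP'; rewrite hx2 ex; move: hm; rewrite intrD.
    by rewrite -e; split=> //; congr pair; apply: eqQ; rewrite hx2.
  case=> -[l [-> ->]].
    split.
      split=> //; rewrite -(ler_pM2l Qpos m%:~R) -(ler_pM2l Qpos x1) hx1 hQ; lra.
    exists (n + 2 * m + 1 - a); split=> //; right.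
    by rewrite intrB !intrD intrM hx1; lra.
  move: hb hx2 l; case: b => hb hx2 l.
    split.
      split=> //; rewrite -(ler_pM2l P0 m%:~R) -(ler_pM2l P0 x2) hx2; lra.
    exists (n + a); split=> //; left; rewrite hx2 intrD; lra.
  split.
    split=> //; rewrite -(ler_pM2l Qpos m%:~R) -(ler_pM2l Qpos x2) hx2 hQ; lra.
  exists (n + 2 * m + 2 - a); split=> //; right.
  by rewrite hx2 intrB !intrD intrM; lra.
(* Since [P + Q = 2], adding the equations of the P-line and the Q-line gives [2 x = 2 m + 1]. Two
   distinct Q-lines never coincide on the edge. *)
- case=> e; split=> //; congr pair; move: hx1 hx2; rewrite -e.
  by move=> h1; case: (b) => h2; move: h1 h2; rewrite hQ; lra.
- case=> _ [e]; move: hx1 mid hb; rewrite e => h; case: (b) => h' h1.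
    by apply: h'; move: h; rewrite hQ; lra.
  by exfalso; move: h h1; rewrite hQ; lra.
- case=> _ [e]; move: hx2 mid hb; rewrite e; case: (b) => h; first by move=> + _; apply.
  by move=> _ _; exfalso; move: h; rewrite hQ; lra.
Qed.

End Good.

(** * Capacities *)

Lemma sum_unique_le1 n (b : nat -> bool) :
  (forall i j, (i < n)%N -> (j < n)%N -> b i -> b j -> i = j) ->
  (\sum_(i < n) b i <= 1)%N.
Proof.
move=> h; have [[i bi]|none] := pselect (exists i : 'I_n, b i).
  rewrite (bigD1 i) //= bi big1 // => j /negP ji.
  by case bj: (b j) => //; case: ji; apply/eqP/val_inj/(h j i (ltn_ord j) (ltn_ord i)).
by rewrite big1 // => i _; case bi: (b i) => //; case: none; exists i.
Qed.

Section Count.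
Variables (R : realType) (p q : nat).
Hypothesis pq : even_param p q.
Notation w := (p + q)%N.
Notation P := (bigP R p q).
Notation lit := (@lit R p q).
Notation top := (top R p q).
Notation vgood := (vgood R p q).
Notation hgood := (hgood R p q).

(* half the capacity of the i-th grid line: [mod2 (2 P i) = +- 2 (half_cap i) / w] *)
Definition half_cap (i : nat) : nat :=
  let u := ((2 * p * i) %% w)%N in minn u (w - u).

Definition cap_sign (i : nat) : int :=
  if (2 * ((2 * p * i) %% w) < w)%N then 1 else -1.

Lemma bigP_w (c : int) : w%:R * (P * c%:~R) = (2 * p%:Z * c)%:~R.
Proof. by rewrite mulrA [w%:R * _]mulrC bigPw // !intrM. Qed.

Lemma mod2_line (i : nat) :
  w%:R * mod2 (2 * P * i%:Z%:~R) = (2 * cap_sign i * (half_cap i)%:Z)%:~R.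
Proof.
have w0 := w_gt0 R pq; rewrite /half_cap /cap_sign.
have [_ _ _ od _] := even_paramP pq.
have := divn_eq (2 * p * i) w; have : ((2 * p * i) %% w < w)%N.
  by rewrite ltn_mod; move: od; case: (w).
set u := (_ %% _)%N; set t := (_ %/ _)%N => uw et.
have ePi : w%:R * (P * i%:Z%:~R) = t%:R * w%:R + u%:R.
  rewrite bigP_w; have -> : 2 * p%:Z * i%:Z = (t * w + u)%N by rewrite -et; lia.
  by rewrite -pmulrn (natrD _ (t * w)) natrM.
have [lt|ge] := ltnP (2 * u) w.
  have -> : minn u (w - u) = u by lia.
  have lt' : 2 * u%:R < w%:R :> R by rewrite -natrM ltr_nat.
  rewrite (@mod2_unique _ _ (2 * u%:R / w%:R) t%:Z); first last.
  - apply: (mulfI (lt0r_neq0 w0)).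
    have -> : w%:R * (2 * P * i%:Z%:~R) = 2 * (w%:R * (P * i%:Z%:~R)) by ring.
    rewrite ePi [RHS]mulrDr [w%:R * (_ / _)]mulrC divfK ?lt0r_neq0 //.
    by rewrite -pmulrn; ring.
  - rewrite ltr_pdivlMr // ler_pdivrMr //.
    have := ler0n R u; lra.
  by rewrite mulrC divfK ?lt0r_neq0 // mulr1 intrM.
have gt' : w%:R < 2 * u%:R :> R.
  rewrite -natrM ltr_nat ltn_neqAle ge andbT; apply: contraL od => /eqP ->.
  by rewrite oddM.
have -> : minn u (w - u) = (w - u)%N by lia.
have uw' : u%:R < w%:R :> R by rewrite ltr_nat.
rewrite (@mod2_unique _ _ (2 * (u%:R - w%:R) / w%:R) (t%:Z + 1)); first last.
- apply: (mulfI (lt0r_neq0 w0)).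
  have -> : w%:R * (2 * P * i%:Z%:~R) = 2 * (w%:R * (P * i%:Z%:~R)) by ring.
  rewrite ePi [RHS]mulrDr [w%:R * (_ / _)]mulrC divfK ?lt0r_neq0 //.
  by rewrite intrD -pmulrn; ring.
- by rewrite ltr_pdivlMr // ler_pdivrMr //; lra.
rewrite mulrC divfK ?lt0r_neq0 // !intrM -pmulrn natrB 1?ltnW // !intrN; ring.
Qed.

(** Multiplied by [w], the value of the line becomes an odd integer congruent to [2 p c + w] modulo
    [2 w]. The line is light iff this integer lies between 0 and plus or minus [2 (half_cap i)], and
    the odd integers there are the [2 s + 1] up to sign. *)
Lemma lit_residue (i : nat) (c : int) : lit i c <->
  exists2 s : nat, (s < half_cap i)%N &
    ((2 * w)%:Z %| 2 * p%:Z * c + w%:Z - cap_sign i * (2 * s%:Z + 1))%Z.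
Proof.
have w0 := w_gt0 R pq; have [_ _ _ od _] := even_paramP pq.
have [k hk] := mod2E (P * c%:~R + 1); set f := mod2 _ in hk.
pose F : int := 2 * p%:Z * c + w%:Z - 2 * k * w%:Z.
have hf : w%:R * f = F%:~R.
  have -> : f = P * c%:~R + 1 - 2 * k%:~R by rewrite hk; ring.
  rewrite mulrBr mulrDr bigP_w /F intrB intrD mulr1 !intrM -!pmulrn; ring.
have hg := mod2_line i; set g := mod2 _ in hg.
have sg1 : cap_sign i = 1 \/ cap_sign i = -1.
  by rewrite /cap_sign; case: ifP; [left|right].
have hF : f \in `]-1, 1]%R by rewrite in_itv /=; exact: mod2_itv.
have [hF1 hF2] : - w%:Z < F /\ F <= w%:Z.
  move: hF; rewrite in_itv /= -(ltr_pM2l w0) -[f <= 1](ler_pM2l w0) hf.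
  rewrite mulrN mulr1 => /andP[].
  by rewrite !pmulrn -intrN ltr_int ler_int.
have hle : (2 * half_cap i <= w)%N.
  by rewrite /half_cap; lia.
have key : lit i c <-> 0 < cap_sign i * F < 2 * (half_cap i)%:Z.
  apply: iff_trans (litP R pq _ _) _; rewrite -/f -/g.
  have w2 : 0 < w%:R * w%:R :> R by rewrite mulr_gt0.
  rewrite -(ltr_pM2l w2) mulr0 -(ltr_pM2l w0 `|f|).
  have -> : w%:R * w%:R * (g * f) = (w%:R * g) * (w%:R * f) by ring.
  rewrite -[X in _ /\ X * _ < X * _](gtr0_norm w0) -!normrM hf hg -intrM ltr0z.
  rewrite -!intr_norm ltr_int.
  clear -sg1; case: sg1 => ->; split=> [[h1 h2]|/andP[h1 h2]]; try split; nia.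
apply: iff_trans key _; split=> [hs|[s hs /dvdzP[l hl]]].
  have oF : (F %% 2)%Z = 1 by rewrite /F; clear -od; lia.
  exists `|((cap_sign i * F - 1) %/ 2)%Z|%N.
    by clear -hs sg1 oF; case: sg1 hs => ->; lia.
  have -> : cap_sign i * (2 * `|((cap_sign i * F - 1) %/ 2)%Z|%N%:Z + 1) = F.
    by clear -hs sg1 oF; case: sg1 hs => ->; lia.
  by apply/dvdzP; exists k; rewrite /F; ring.
suff -> : F = cap_sign i * (2 * s%:Z + 1) by clear -hs sg1; case: sg1 => ->; nia.
have eF : F = cap_sign i * (2 * s%:Z + 1) + (l - k) * (2 * w)%N%:Z.
  by rewrite mulrBl -hl /F; ring.
have hs' : `|cap_sign i * (2 * s%:Z + 1)| < w%:Z.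
  have w2s : (2 * s + 1 != w)%N.
    apply/eqP => e; move: hle hs; lia.
  by clear -sg1 hs hle w2s; case: sg1 => ->; lia.
have -> : F = cap_sign i * (2 * s%:Z + 1); last by [].
have lk : l - k = 0.
  have : `|(l - k) * (2 * w)%N%:Z| < (2 * w)%N%:Z.
    by clear -eF hs' hF1 hF2; lia.
  by rewrite normrM; clear -w0; nia.
by rewrite eF lk mul0r addr0.
Qed.

(** As [2 p] is invertible modulo [w], each [s] in [lit_residue] fixes the intercept modulo [w]. *)
Lemma lit_count (i : nat) (c : int) :
  (\sum_(j < w) lit i (c + j%:Z) <= half_cap i)%N.
Proof.
pose r (j s : nat) := ((2 * w)%:Z %|
  2 * p%:Z * (c + j%:Z) + w%:Z - cap_sign i * (2 * s%:Z + 1))%Z.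
apply: (@leq_trans (\sum_(j < w) \sum_(s < half_cap i) r j s)).
  apply: leq_sum => j _; case h: (lit _ _) => //.
  have [s hs hr] := (lit_residue i (c + j%:Z)).1 h.
  by rewrite (bigD1 (Ordinal hs)) //= /r hr.
rewrite exchange_big /=.
apply: (@leq_trans (\sum_(s < half_cap i) 1)); last first.
  by rewrite sum_nat_const card_ord muln1.
apply: leq_sum => s _; apply: (sum_unique_le1 (b := fun j => r j s)) => j j' hj hj' hr hr'.
have : ((2 * w)%:Z %| 2 * (p%:Z * (j%:Z - j'%:Z)))%Z.
  have -> : 2 * (p%:Z * (j%:Z - j'%:Z)) =
    (2 * p%:Z * (c + j%:Z) + w%:Z - cap_sign i * (2 * s%:Z + 1)) -
    (2 * p%:Z * (c + j'%:Z) + w%:Z - cap_sign i * (2 * s%:Z + 1)) by ring.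
  exact: rpredB.
rewrite PoszM dvdz_mul2l // => h.
have /dvdzP[k hk] : (w%:Z %| j%:Z - j'%:Z)%Z.
  by apply: (dvd_w pq); rewrite -mulrA dvdz_mull.
suff k0 : k = 0 by move: hk; rewrite k0 mul0r; clear; lia.
have [h1 h2] : - w%:Z < k * w%:Z /\ k * w%:Z < w%:Z.
  by rewrite -hk; clear -hj hj'; lia.
by clear -h1 h2; move: (w%:Z) h1 h2 => b; nia.
Qed.

(** The P-intercepts of the [w] edges are consecutive integers and so are the Q-intercepts;
    [lit_count] applies to each run. *)
Lemma vgood_count (x : nat) :
  (\sum_(y < w) vgood x y%:Z <= 2 * half_cap x)%N.
Proof.
rewrite mul2n -addnn; apply: leq_trans (leq_add (lit_count x (top x))
  (lit_count x (2 * x%:Z + 1 - top x))).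
rewrite -big_split /=; apply: leq_sum => y _; rewrite /vgood.
have -> : y%:Z + 2 * x%:Z + 1 - top x = 2 * x%:Z + 1 - top x + y%:Z by ring.
by rewrite addrC; do 2!case: lit.
Qed.

Lemma topE (m : nat) : top m = ((2 * p * m) %/ w)%N%:Z + 1.
Proof.
have w0 := w_gt0 R pq; apply: top_unique; rewrite intrD addrK.
have hPm := bigP_w m.
have [_ _ _ od _] := even_paramP pq.
have h1 := leq_divM (2 * p * m) w.
have h2 : (2 * p * m < ((2 * p * m) %/ w).+1 * w)%N.
  by rewrite -ltn_divLR //; move: od; case: (w).
rewrite -(ler_pM2l w0) -[_ < _ + _](ltr_pM2l w0) hPm.
rewrite -[w%:R]/(w%:Z%:~R) -intrD -!intrM ler_int ltr_int; lia.
Qed.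

(* On [y = n] the P-lines meeting [0 < x <= w] have intercepts [n + 1 .. n + 2p],
   the Q-lines meeting [0 <= x < w] have intercepts [n .. n + 2q - 1]. *)
Lemma hgood_count (y : nat) :
  (\sum_(x < w) hgood x%:Z y <= 2 * half_cap y)%N.
Proof.
pose e M := ((2 * p * M) %/ w)%N.
have [p0 lpq _ od _] := even_paramP pq.
have e2 M : (e M <= 2 * M)%N.
  by rewrite /e -ltnS ltn_divLR; clear -p0; nia.
(* The first [M] edges use the next [e M] intercepts of P-lines and the next [2 M - e M] intercepts
   of Q-lines; an edge extends either both runs by one or the second by two. *)
have partial M : (\sum_(x < M) hgood x%:Z y <=
    \sum_(j < e M) lit y (y%:Z + 1 + j%:Z) +
    \sum_(j < 2 * M - e M) lit y (y%:Z + j%:Z))%N.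
  elim: M => [|M IH]; first by rewrite big_ord0.
  rewrite big_ord_recr /=; apply: leq_trans (leq_add IH (leqnn _)) _.
  rewrite /hgood; have hM := e2 M; have hM1 := e2 M.+1.
  have := top_step R pq M%:Z; rewrite -[M%:Z + 1]/((M + 1)%N%:Z) addn1 !topE -/(e M) -/(e M.+1).
  case=> /eqP; rewrite ?(inj_eq (addIr 1)) => /eqP eM.
    have {}eM : e M.+1 = e M by case: eM.
    rewrite eM.
    have -> : ((e M)%:Z == (e M)%:Z + 1) = false by clear; apply/eqP; lia.
    have -> : (2 * M.+1 - e M = (2 * M - e M).+2)%N by lia.
    rewrite !big_ord_recr /= -addnA leq_add2l -addnA leq_add2l.
    have -> : y%:Z + 2 * M%:Z + 1 - ((e M)%:Z + 1) = y%:Z + (2 * M - e M)%N by lia.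
    have -> : y%:Z + 2 * M%:Z + 2 - ((e M)%:Z + 1) = y%:Z + (2 * M - e M).+1 by lia.
    by do 2!case: lit.
  have {}eM : e M.+1 = (e M).+1 by move: eM; clear; lia.
  rewrite eM; have -> : ((e M).+1%:Z == (e M)%:Z + 1) by clear; apply/eqP; lia.
  have -> : (2 * M.+1 - (e M).+1 = (2 * M - e M).+1)%N by lia.
  rewrite !big_ord_recr /= addnACA leq_add2l.
  have -> : y%:Z + 2 * M%:Z + 1 - ((e M)%:Z + 1) = y%:Z + (2 * M - e M)%N by lia.
  have -> : y%:Z + ((e M)%:Z + 1) = y%:Z + 1 + (e M)%:Z by ring.
  by rewrite addnC; do 2!case: lit.
apply: leq_trans (partial w) _.
have -> : e w = (2 * p)%N by rewrite /e mulnK //; lia.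
have -> : (2 * w - 2 * p = 2 * q)%N by lia.
(* Reflecting the Q-intercepts about [y] places them just before the P-intercepts, which gives [2 w]
   consecutive integers. *)
have -> : (\sum_(j < 2 * q) lit y (y%:Z + j%:Z) =
    \sum_(j < 2 * q) lit y (y%:Z + 1 - (2 * q)%:Z + j%:Z))%N.
  rewrite (reindex_inj rev_ord_inj) /=; apply: eq_bigr => j _; congr nat_of_bool.
  apply: (lit_sym R pq).
  have -> : y%:Z + (2 * q - j.+1)%N + (y%:Z + 1 - (2 * q)%N%:Z + j%:Z) - 2 * y%:Z = 0.
    by have := ltn_ord j; lia.
  exact: dvdz0.
have -> : (\sum_(j < 2 * p) lit y (y%:Z + 1 + j%:Z) +
    \sum_(j < 2 * q) lit y (y%:Z + 1 - (2 * q)%:Z + j%:Z) =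
    \sum_(j < w + w) lit y (y%:Z + 1 - (2 * q)%:Z + j%:Z))%N.
  have -> : (w + w = 2 * q + 2 * p)%N by lia.
  rewrite [RHS]big_split_ord /= [RHS]addnC; congr (_ + _)%N.
  by apply: eq_bigr => j _; congr (nat_of_bool (lit _ _)); rewrite PoszD; ring.
rewrite big_split_ord /= -[(2 * half_cap y)%N]/(half_cap y + (half_cap y + 0))%N addn0.
apply: leq_add; first exact: lit_count.
apply: leq_trans (lit_count y (y%:Z + 1 - (2 * q)%:Z + w%:Z)).
by apply: leq_sum => j _; rewrite [(_ + j)%N%:Z]PoszD addrA.
Qed.

End Count.

(** * Uncrossed rectangles *)

Section Grid.
Local Open Scope nat_scope.
Variables (w : nat) (V H : nat -> nat -> bool).
Hypothesis even_sq : forall x y, x < w -> y < w ->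
  V x y (+) V x.+1 y (+) H x y (+) H x y.+1 = false.

Lemma column_parity (W : nat -> bool) x y0 n : x < w -> y0 + n <= w ->
  (forall y, y.+1 < n -> H x (y0 + y.+1) -> W y = W y.+1) ->
  odd (\sum_(y < n) (W y && V x (y0 + y))) (+)
  odd (\sum_(y < n) (W y && V x.+1 (y0 + y))) =
  (W 0 && H x y0) (+) (W n.-1 && H x (y0 + n)).
Proof.
move=> xw; elim: n => [|n IH] nw hW; first by rewrite !big_ord0 addn0 /= addbb.
rewrite !big_ord_recr /= !oddD addbACA IH; last 2 first.
- by rewrite addnS in nw; apply: ltnW.
- by move=> y yn; apply: hW; apply: ltnW.
have -> : (W n.-1 && H x (y0 + n)) = (W n && H x (y0 + n)).
  case: n hW {IH nw} => // n hW; case h: (H x _); rewrite ?andbF ?andbT //.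
  exact: hW.
have := @even_sq x (y0 + n) xw; rewrite -addnS => /(_ nw).
by case: (V x _); case: (V _ _); case: (H _ (y0 + n)); case: (H _ (_ + _));
  case: (W n); case: (W 0); case: (H _ _).
Qed.

Lemma box_even x0 a y0 b : x0 + a <= w -> y0 + b <= w ->
  ~~ odd (\sum_(y < b) (V x0 (y0 + y) + V (x0 + a) (y0 + y)) +
          \sum_(x < a) (H (x0 + x) y0 + H (x0 + x) (y0 + b))).
Proof.
move=> + bw; elim: a => [|a IH] aw.
  rewrite big_ord0 !addn0 big_split /= addnn odd_double //.
move: IH; rewrite addnS in aw *; move/(_ (ltnW aw)).
have := @column_parity xpredT (x0 + a) y0 b aw bw (fun _ _ _ => erefl).
rewrite /= big_ord_recr !big_split /= !oddD.
do 4!case: (odd (\sum_(y < b) _)) => /=; do 2!case: (odd (\sum_(x < a) _)) => /=;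
  by case: (H _ _); case: (H _ _).
Qed.

(** In the application [W] marks the squares whose centers lie on one polygon. Since no edge on the
    border is good, the polygon can leave the first columns only through the line [m + 1]. *)
Lemma handshake (W : nat -> nat -> bool) m : m < w ->
  (forall y, V 0 y = false) -> (forall x, H x 0 = false) -> (forall x, H x w = false) ->
  (forall x y, x < m -> y < w -> V x.+1 y -> W x y = W x.+1 y) ->
  (forall x y, x <= m -> y.+1 < w -> H x y.+1 -> W x y = W x y.+1) ->
  ~~ odd (\sum_(y < w) (W m y && V m.+1 y)).
Proof.
move=> + V0 H0 Hw; elim: m => [|m IH] mw hV hH.
  have := @column_parity (W 0) 0 0 w mw (leqnn _).
  rewrite H0 Hw !andbF => /(_ (fun y => hH 0 y (leqnn _))).
  rewrite [X in odd X (+) _]big1 /= => [->//|y _].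
  by rewrite V0 andbF.
have := @column_parity (W m.+1) m.+1 0 w mw (leqnn _).
rewrite H0 Hw !andbF => /(_ (fun y => hH m.+1 y (leqnn _))).
rewrite (eq_bigr (fun y : 'I_w => nat_of_bool (W m y && V m.+1 y))) => [|y _].
  rewrite (negbTE (IH _ _ _)) => [/= ->//|||].
  - exact: ltnW.
  - by move=> x y xm; apply: hV; apply: ltnW.
  - by move=> x y xm; apply: hH; apply: leqW.
by case h: (V _ _); rewrite ?andbF ?andbT //; congr nat_of_bool; rewrite (hV m y).
Qed.

Variables (r : nat) (s : nat -> nat).
Hypotheses (s0 : s 0 = 0) (sr : s r = w).
Hypothesis s_mono : forall i, i < r -> s i <= s i.+1.

Lemma sum_gaps (F : nat -> nat) i : i <= r ->
  \sum_(j < i) \sum_(y < s j.+1 - s j) F (s j + y) = \sum_(y < s i) F y.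
Proof.
elim: i => [|i IH] ir; first by rewrite !big_ord0 s0 big_ord0.
rewrite big_ord_recr /= IH ?(ltnW ir) //.
by rewrite -[in RHS](subnKC (s_mono ir)) big_split_ord.
Qed.

Lemma sum_shift (F : nat -> nat) : F w = F 0 ->
  \sum_(i < r) F (s i.+1) = \sum_(i < r) F (s i).
Proof.
move=> e; apply: (@addnI (F (s 0))).
have <- : \sum_(i < r.+1) F (s i) = F (s 0) + \sum_(i < r) F (s i.+1).
  by rewrite big_ord_recl.
by rewrite big_ord_recr /= sr s0 e addnC.
Qed.

Hypotheses (V0 : forall y, V 0 y = false) (Vw : forall y, V w y = false).
Hypotheses (H0 : forall x, H x 0 = false) (Hw : forall x, H x w = false).

(* Each crossing is counted by the two adjacent rectangles, so on average a
   rectangle has fewer than two; by parity some rectangle has none. *)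
Lemma uncrossed_rectangle :
  \sum_(i < r) \sum_(y < w) V (s i) y + \sum_(j < r) \sum_(x < w) H x (s j) < r * r ->
  exists i j, [/\ i < r, j < r,
    forall y, s j <= y < s j.+1 -> V (s i) y = false /\ V (s i.+1) y = false &
    forall x, s i <= x < s i.+1 -> H x (s j) = false /\ H x (s j.+1) = false].
Proof.
move=> few.
have s_le i : i <= r -> s i <= w.
  move=> ir; rewrite -(subKn ir) -sr.
  elim: (r - i) (leq_subr i r) => [|d IH] dr; first by rewrite subn0.
  apply: leq_trans (IH (ltnW dr)).
  have -> : r - d = (r - d.+1).+1 by rewrite subnSK.
  by apply: s_mono; lia.
pose nv i j := \sum_(y < s j.+1 - s j) (V (s i) (s j + y) + V (s i.+1) (s j + y)).
pose nh i j := \sum_(x < s i.+1 - s i) (H (s i + x) (s j) + H (s i + x) (s j.+1)).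
have even_n i j : i < r -> j < r -> ~~ odd (nv i j + nh i j).
  move=> ir jr; have hi := subnKC (s_mono ir); have hj := subnKC (s_mono jr).
  have := @box_even (s i) (s i.+1 - s i) (s j) (s j.+1 - s j).
  by rewrite hi hj !s_le //; apply.
have total : \sum_(i < r) \sum_(j < r) (nv i j + nh i j) < 2 * (r * r).
  suff -> : \sum_(i < r) \sum_(j < r) (nv i j + nh i j) =
    2 * (\sum_(i < r) \sum_(y < w) V (s i) y + \sum_(j < r) \sum_(x < w) H x (s j)).
    by rewrite ltn_pmul2l.
  under eq_bigr do rewrite big_split.
  rewrite big_split mulnDr /=; congr addn.
    under eq_bigr => i _ do rewrite
      (sum_gaps (fun y => V (s i) y + V (s i.+1) y) (leqnn r)) sr big_split /=.
    rewrite big_split /= mul2n -addnn; congr addn.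
    apply: (@sum_shift (fun x => \sum_(y < w) V x y)).
    by rewrite !big1 // => y _; rewrite ?V0 ?Vw.
  rewrite exchange_big /=.
  under eq_bigr => j _ do rewrite
    (sum_gaps (fun x => H x (s j) + H x (s j.+1)) (leqnn r)) sr big_split /=.
  rewrite big_split /= mul2n -addnn; congr addn.
  apply: (@sum_shift (fun y => \sum_(x < w) H x y)).
  by rewrite !big1 // => y _; rewrite ?H0 ?Hw.
have [i [j n0]] : exists i j : 'I_r, nv i j + nh i j = 0.
  have [//|none] := pselect (exists i j : 'I_r, nv i j + nh i j = 0).
  move: total; rewrite ltnNge => /negP[].
  apply: (@leq_trans (\sum_(i < r) \sum_(j < r) 2)).
    by rewrite !sum_nat_const !card_ord; lia.
  apply: leq_sum => i _; apply: leq_sum => j _.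
  have := even_n i j (ltn_ord i) (ltn_ord j).
  case e: (nv i j + nh i j) => [|[|k]] //; by case: none; exists i, j.
move/eqP: n0; rewrite addn_eq0 !sum_nat_eq0 => /andP[/forallP nv0 /forallP nh0].
exists i, j; split=> // [y|x] /andP[h1 h2].
  have hy : y - s j < s j.+1 - s j by lia.
  have := nv0 (Ordinal hy); rewrite /= subnKC // addn_eq0.
  by case: (V _ _); case: (V _ _).
have hx : x - s i < s i.+1 - s i by lia.
have := nh0 (Ordinal hx); rewrite /= subnKC // addn_eq0.
by case: (H _ _); case: (H _ _).
Qed.

End Grid.

(** * Distribution of the capacities over the grid lines *)

Section HalfCaps.
Local Open Scope nat_scope.
Variables p q : nat.
Hypothesis pq : even_param p q.
Notation w := (p + q).

Lemma sum_fold (G : nat -> nat) h :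
  \sum_(u < 2 * h + 1) G (minn u (2 * h + 1 - u)) = G 0 + 2 * \sum_(u < h) G u.+1.
Proof.
have -> : 2 * h + 1 = h.+1 + h by lia.
rewrite big_split_ord big_ord_recl /= min0n -addnA mul2n -addnn; congr (_ + (_ + _)).
  by apply: eq_bigr => u _; congr G; have := ltn_ord u; rewrite /bump /=; lia.
rewrite (reindex_inj rev_ord_inj) /=.
by apply: eq_bigr => u _; congr G; have := ltn_ord u; lia.
Qed.

(** Multiplication by [2 p] permutes the residues modulo [w], so each value [1 .. (w - 1) / 2]
    belongs to two lines and 0 to one. *)
Lemma sum_half_cap (G : nat -> nat) :
  \sum_(x < w) G (half_cap p q x) = G 0 + 2 * \sum_(u < w./2) G u.+1.
Proof.
have [p0 _ cop od _] := even_paramP pq.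
have w0 : 0 < w by lia.
pose f (x : 'I_w) : 'I_w := Ordinal (ltn_pmod (2 * p * x) w0).
have f_inj : injective f.
  move=> x y /(congr1 val) /= /eqP e; apply/val_inj/eqP => /=.
  have := e; rewrite -(modn_small (ltn_ord x)) -(modn_small (ltn_ord y)) !modnMmr.
  move: e; wlog le : x y / x <= y.
    by move=> hw e _; case/orP: (leq_total x y) => h; [|rewrite eq_sym]; apply: hw;
      rewrite // eq_sym.
  rewrite eq_sym eqn_mod_dvd ?leq_mul2l ?le ?orbT // -mulnBr.
  rewrite Gauss_dvdr; last by rewrite coprimeMr coprimen2 od coprime_sym.
  by rewrite -eqn_mod_dvd // eq_sym.
rewrite -(reindex_inj f_inj (P := xpredT) (F := fun u : 'I_w => G (minn u (w - u)))) /=.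
have wE : 2 * w./2 + 1 = w by rewrite -[RHS]odd_double_half od; lia.
by have := sum_fold G w./2; rewrite wE.
Qed.

(** The leading factor 2 stands for the two directions of grid lines. The margin is exactly one:
    [(2 K + 1) ^ 2 = 4 K (K + 1) + 1]. *)
Lemma few_crossings K : 2 * K < w ->
  2 * \sum_(x < w | half_cap p q x <= K) (2 * half_cap p q x) <
  (\sum_(x < w | half_cap p q x <= K) 1) * (\sum_(x < w | half_cap p q x <= K) 1).
Proof.
move=> hK; pose low x := half_cap p q x <= K.
have trunc (g : nat -> nat) : \sum_(u < w./2) (if u.+1 <= K then g u.+1 else 0) =
    \sum_(u < K) g u.+1.
  have KD : K <= w./2 by lia.
  rewrite -(subnKC KD) big_split_ord /= [X in _ + X]big1 ?addn0 => [|u _].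
    by apply: eq_bigr => u _; rewrite ltn_ord.
  by rewrite ifF //; lia.
have -> : \sum_(x < w | low x) 1 = 2 * K + 1.
  rewrite big_mkcond /= (sum_half_cap (fun k => if k <= K then 1 else 0)) /=.
  by rewrite (trunc (fun=> 1)) sum_nat_const card_ord; lia.
have -> : \sum_(x < w | low x) (2 * half_cap p q x) = 2 * (K * K.+1).
  rewrite big_mkcond /= (sum_half_cap (fun k => if k <= K then 2 * k else 0)) /=.
  rewrite (trunc (fun k => 2 * k)) muln0 add0n; congr (2 * _).
  by elim: (K) => [|k IH]; rewrite ?big_ord0 // big_ord_recr /= IH; lia.
lia.
Qed.

End HalfCaps.

(** * Topology of plaid polygons *)

Section Polygons.
Variables (R : realType) (p q : nat).
Notation good := (@good R p q).
Notation plaid_union := (@plaid_union R p q).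

Lemma affine_continuous (u v : R) : continuous (fun t : R => u + t * v).
Proof.
move=> t; apply: (@continuousD _ _ _ (fun=> u) (fun t : R => t * v)).
  exact: cst_continuous.
apply: (@continuousM _ _ (fun t : R => t) (fun=> v)); first exact: cvg_id.
exact: cst_continuous.
Qed.

Lemma connected_segment (a b : R * R) : connected (segment a b).
Proof.
have -> : segment a b = (fun t : R => (a.1 + t * (b.1 - a.1), a.2 + t * (b.2 - a.2)))
    @` `[0, 1].
  apply/seteqP; split=> z /=.
    by case=> t [ht ->]; exists t => //; rewrite in_itv.
  by case=> t; rewrite /= in_itv /= => ht <-; exists t.
apply: connected_continuous_connected; first exact: segment_connected.
apply: continuous_subspaceT => t.
exact: (cvg_pair (@affine_continuous a.1 (b.1 - a.1) t)
  (@affine_continuous a.2 (b.2 - a.2) t)).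
Qed.

Lemma segment_left (a b : R * R) : segment a b a.
Proof. by exists 0; split; [lra|rewrite !mul0r !addr0 -surjective_pairing]. Qed.

Lemma segment_right (a b : R * R) : segment a b b.
Proof. by exists 1; split; [lra|rewrite !mul1r ![_ + (_ - _)]addrC !subrK -surjective_pairing]. Qed.

Lemma plaid_polygon_mem C z : @plaid_polygon R p q C -> C z ->
  C = connected_component plaid_union z.
Proof. by case=> x [_ ->]; exact: same_connected_component. Qed.

Lemma plaid_polygon_edge C m n s : @plaid_polygon R p q C -> good s ->
  square_edge m n s -> C (sq_center R m n) <-> C (seg_mid R s).
Proof.
move=> hC hs me.
have sub : segment (sq_center R m n) (seg_mid R s) `<=` plaid_union.
  by move=> z hz; exists m, n, s.
split=> h; rewrite (plaid_polygon_mem hC h).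
  exact: (connected_component_max (@segment_left _ _) sub (@connected_segment _ _)
    (@segment_right _ _)).
exact: (connected_component_max (@segment_right _ _) sub (@connected_segment _ _)
  (@segment_left _ _)).
Qed.

Lemma plaid_polygon_good s m n : good s -> square_edge m n s ->
  @plaid_polygon R p q (connected_component plaid_union (seg_mid R s)).
Proof.
move=> hs me; exists (seg_mid R s); split=> //.
by exists m, n, s; split=> //; split=> //; exact: segment_right.
Qed.

Definition box (X0 X1 Y0 Y1 : int) : set (R * R) :=
  [set z | X0%:~R <= z.1 <= X1%:~R /\ Y0%:~R <= z.2 <= Y1%:~R].

Definition open_box (X0 X1 Y0 Y1 : int) : set (R * R) :=
  [set z | X0%:~R < z.1 < X1%:~R /\ Y0%:~R < z.2 < Y1%:~R].

Lemma closed_box X0 X1 Y0 Y1 : closed (box X0 X1 Y0 Y1).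
Proof.
have -> : box X0 X1 Y0 Y1 =
  ((fst @^-1` [set x : R | X0%:~R <= x]) `&` (fst @^-1` [set x : R | x <= X1%:~R])) `&`
  ((snd @^-1` [set x : R | Y0%:~R <= x]) `&` (snd @^-1` [set x : R | x <= Y1%:~R])).
  apply/seteqP; split=> z /=; first by case=> /andP[? ?] /andP[? ?].
  by case=> [[? ?] [? ?]]; split; apply/andP.
by apply: closedI; apply: closedI; apply: preimage_closed;
  do ?[by move=> y _; exact: cvg_fst | by move=> y _; exact: cvg_snd
      | exact: closed_le | exact: closed_ge].
Qed.

Lemma open_open_box X0 X1 Y0 Y1 : open (open_box X0 X1 Y0 Y1).
Proof.
have -> : open_box X0 X1 Y0 Y1 =
  ((fst @^-1` [set x : R | X0%:~R < x]) `&` (fst @^-1` [set x : R | x < X1%:~R])) `&`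
  ((snd @^-1` [set x : R | Y0%:~R < x]) `&` (snd @^-1` [set x : R | x < Y1%:~R])).
  apply/seteqP; split=> z /=; first by case=> /andP[? ?] /andP[? ?].
  by case=> [[? ?] [? ?]]; split; apply/andP.
by apply: openI; apply: openI; apply: open_comp;
  do ?[by move=> y _; exact: cvg_fst | by move=> y _; exact: cvg_snd
      | exact: open_lt | exact: open_gt].
Qed.

Definition uncrossed (X0 X1 Y0 Y1 : int) : Prop :=
  (forall n, Y0 <= n < Y1 -> ~ good (USeg Ver X0 n) /\ ~ good (USeg Ver X1 n)) /\
  (forall m, X0 <= m < X1 -> ~ good (USeg Hor m Y0) /\ ~ good (USeg Hor m Y1)).

(** Consequently a polygon can cross the boundary of a rectangle only at the midpoint of a good edge
    of that boundary. *)
Lemma plaid_grid_point (m n : int) (s : unit_seg) (z : R * R) :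
  square_edge m n s -> segment (sq_center R m n) (seg_mid R s) z ->
  (forall k : int, z.1 = k%:~R -> z = seg_mid R s /\ s = USeg Ver k n) /\
  (forall k : int, z.2 = k%:~R -> z = seg_mid R s /\ s = USeg Hor m k).
Proof.
have no_half (k j : int) : j%:~R + 2^-1 <> k%:~R :> R.
  move=> e; have e2 : (2 * j + 1)%:~R = (2 * k)%:~R :> R.
    by rewrite intrD !intrM -e; field.
  by have := @intr_inj R _ _ e2; lia.
have mid (t : R) (k j : int) : 0 <= t <= 1 ->
    j%:~R + 2^-1 + t * (j%:~R - (j%:~R + 2^-1)) = k%:~R -> t = 1 /\ k = j.
  move=> ht e; have kj : k = j.
    by apply: (@int_near R); rewrite -e ltr_norml; lra.
  by split=> //; move: e; rewrite kj; lra.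
have mid' (t : R) (k j : int) : 0 <= t <= 1 ->
    j%:~R + 2^-1 + t * ((j + 1)%:~R - (j%:~R + 2^-1)) = k%:~R -> t = 1 /\ k = j + 1.
  rewrite intrD => ht e; have kj : k = j + 1.
    by apply: (@int_near R); rewrite -e intrD ltr_norml; lra.
  by split=> //; move: e; rewrite kj intrD; lra.
have one (u v t : R) : t = 1 -> u + t * (v - u) = v by move=> ->; ring.
have const (u t : R) : u + t * (u - u) = u by ring.
move=> me [t [ht ->]]; split=> k /=.
  move: me; case=> [|[|[|]]] -> /=; rewrite ?const.
  - by move/no_half.
  - by move/no_half.
  - by move/(mid _ _ _ ht) => [t1 ->]; rewrite (one _ _ _ t1).
  - by move/(mid' _ _ _ ht) => [t1 ->]; rewrite (one _ _ _ t1).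
move: me; case=> [|[|[|]]] -> /=; rewrite ?const.
- by move/(mid _ _ _ ht) => [t1 ->]; rewrite (one _ _ _ t1).
- by move/(mid' _ _ _ ht) => [t1 ->]; rewrite (one _ _ _ t1).
- by move/no_half.
- by move/no_half.
Qed.

Lemma uncrossed_interior X0 X1 Y0 Y1 z : uncrossed X0 X1 Y0 Y1 ->
  plaid_union z -> box X0 X1 Y0 Y1 z -> open_box X0 X1 Y0 Y1 z.
Proof.
move=> [uV uH] [m [n [s [me [gs hz]]]]] [/andP[x0 x1] /andP[y0 y1]].
have [gx gy] := plaid_grid_point me hz.
have noV k : z.1 = k%:~R -> k = X0 \/ k = X1 -> False.
  move=> /gx[ez es] hk; have := gs; rewrite es => gk.
  have [hn|] := boolP (Y0 <= n < Y1).
    by have [] := uV n hn; case: hk => <-.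
  move: y0 y1; rewrite ez es /= => y0 y1 /negP[]; apply/andP; split.
    by rewrite -ltzD1 -(ltr_int R) intrD; lra.
  by rewrite -(ltr_int R); lra.
have noH k : z.2 = k%:~R -> k = Y0 \/ k = Y1 -> False.
  move=> /gy[ez es] hk; have := gs; rewrite es => gk.
  have [hm|] := boolP (X0 <= m < X1).
    by have [] := uH m hm; case: hk => <-.
  move: x0 x1; rewrite ez es /= => x0 x1 /negP[]; apply/andP; split.
    by rewrite -ltzD1 -(ltr_int R) intrD; lra.
  by rewrite -(ltr_int R); lra.
by split; apply/andP; split; rewrite lt_neqAle ?x0 ?x1 ?y0 ?y1 andbT; apply/eqP => e;
  do ?[by apply: (noV X0); auto | by apply: (noV X1); auto
      | by apply: (noH Y0); auto | by apply: (noH Y1); auto].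
Qed.

(** On [C] the closed box agrees with the open one, so its trace is open and closed in the connected
    set [C]. *)
Lemma plaid_polygon_confined X0 X1 Y0 Y1 C z : uncrossed X0 X1 Y0 Y1 ->
  @plaid_polygon R p q C -> C z -> box X0 X1 Y0 Y1 z -> C `<=` box X0 X1 Y0 Y1.
Proof.
move=> uc [x [Ux eC]] Cz bz; have subU : C `<=` plaid_union.
  by rewrite eC; exact: connected_component_sub.
have : connected C by rewrite eC; exact: component_connected.
move=> /(_ (C `&` box X0 X1 Y0 Y1)) <-.
- by move=> y [].
- by exists z.
- exists (open_box X0 X1 Y0 Y1); first exact: open_open_box.
  apply/seteqP; split=> y [Cy hy]; split=> //.
    by apply: uncrossed_interior => //; exact: subU.
  by case: hy => /andP[? ?] /andP[? ?]; split; apply/andP; split; apply: ltW.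
- by exists (box X0 X1 Y0 Y1); first exact: closed_box.
Qed.

End Polygons.

(** * Diophantine approximation *)

Section Diophantine.
Variables (R : realType) (P0 : R).
Hypothesis irr : forall s z : int, s != 0 -> P0 * s%:~R <> z%:~R.

(** At [P0] the finitely many multiples keep a distance [2 d] from the integers; half of it is given
    up when [P0] is replaced by [P]. *)
Lemma away_from_int (M : nat) : exists2 d : R, 0 < d & exists2 t : R, 0 < t &
  forall P, `|P - P0| < t -> forall (s : nat) (z : int), (0 < s <= M)%N ->
    d <= `|P * s%:R - z%:~R|.
Proof.
have [d d0 hd] : exists2 d : R, 0 < d & forall (s : nat) (z : int), (0 < s <= M)%N ->
    2 * d <= `|P0 * s%:R - z%:~R|.
  elim: M => [|M [d d0 IH]]; first by exists 1 => // s z; lia.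
  have /andP[] := floor_itv (P0 * M.+1%:R).
  set f := Num.floor _; rewrite intrD le_eqVlt => /orP[/eqP/esym/(@irr M.+1 f)|f1 f2].
    by case.
  exists (Num.min d (Num.min (P0 * M.+1%:R - f%:~R) (f%:~R + 1 - P0 * M.+1%:R) / 2)).
    by rewrite !lt_min d0 /= divr_gt0 // lt_min; lra.
  move=> s z /andP[s0]; rewrite leq_eqVlt => /orP[/eqP ->|sM].
    apply: (@le_trans _ _ (Num.min (P0 * M.+1%:R - f%:~R) (f%:~R + 1 - P0 * M.+1%:R))).
      by rewrite mulrC -ler_pdivlMr // ge_min lexx orbT.
    have [zf|fz] := lerP z f.
      have zf' : z%:~R <= f%:~R :> R by rewrite ler_int.
      rewrite ge_min; apply/orP; left; apply: le_trans (ler_norm _); lra.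
    have zf' : f%:~R + 1 <= z%:~R :> R by rewrite -[1]/(1%:~R) -intrD ler_int lezD1.
    rewrite ge_min distrC; apply/orP; right; apply: le_trans (ler_norm _); lra.
  apply: le_trans (IH s z _); last by rewrite s0.
  by rewrite ler_pM2l // ge_min lexx.
exists d => //; exists (d / M.+1%:R); first by rewrite divr_gt0.
move=> P; rewrite ltr_pdivlMr // => hP s z hs.
have := hd s z hs.
have -> : P0 * s%:R - z%:~R = (P * s%:R - z%:~R) - (P - P0) * s%:R by ring.
have := ler_normB (P * s%:R - z%:~R) ((P - P0) * s%:R).
have : `|(P - P0) * s%:R| <= `|P - P0| * M.+1%:R.
  rewrite normrM [`|s%:R|]ger0_norm // ler_wpM2l // ler_nat.
  by case/andP: hs => _ /leqW.
lra.
Qed.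

Lemma truncn_bounds (x : R) : 0 <= x -> (Num.truncn x)%:R <= x < (Num.truncn x)%:R + 1.
Proof. by move=> /truncn_itv; rewrite -natr1. Qed.

(** Pigeonhole on the fractional parts of [P0 i / 2]; the halving makes the approximating integer
    even, as the circle has length 2. *)
Lemma dirichlet (e : R) : 0 < e ->
  exists (s : nat) (z : int), (0 < s)%N /\ `|P0 * s%:R - 2 * z%:~R| < e.
Proof.
move=> e0; pose T := (Num.truncn (2 / e)).+1.
have hT : 2 / T%:R < e.
  have /andP[_] := truncn_bounds (ltW (divr_gt0 (ltr0n R 2) e0)).
  by rewrite natr1 -/T ltr_pdivrMr // => h; rewrite ltr_pdivrMr // mulrC.
pose fr (i : nat) : R := P0 * i%:R / 2 - (Num.floor (P0 * i%:R / 2))%:~R.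
have fr_itv i : 0 <= fr i < 1.
  by rewrite /fr; have := floor_itv (P0 * i%:R / 2); rewrite intrD; lra.
have bucket i : (Num.truncn (fr i * T%:R) < T)%N.
  have /andP[f0 f1] := fr_itv i.
  have /andP[h _] := truncn_bounds (mulr_ge0 f0 (ler0n R T)).
  rewrite -(ltr_nat R); apply: le_lt_trans h _.
  by rewrite -[ltRHS]mul1r ltr_pM2r.
pose f (i : 'I_T.+1) : 'I_T := Ordinal (bucket i).
have [i [j [ij fij]]] : exists i j : 'I_T.+1, (i < j)%N /\ f i = f j.
  have : ~ injective f.
    by move/leq_card; rewrite !card_ord ltnn.
  move/injectiveP/injectivePn => [i [j ij fij]].
  by have [h|h|/val_inj h] := ltngtP i j; [exists i, j|exists j, i|rewrite h eqxx in ij].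
exists (j - i)%N, (Num.floor (P0 * j%:R / 2) - Num.floor (P0 * i%:R / 2)).
split; first by rewrite subn_gt0.
have -> : P0 * (j - i)%:R - 2 * (Num.floor (P0 * j%:R / 2) - Num.floor (P0 * i%:R / 2))%:~R
   = 2 * (fr j - fr i).
  by rewrite natrB ?(ltnW ij) // intrB /fr; field.
apply: lt_trans hT; rewrite ltr_pdivlMr // -[X in _ * X](@ger0_norm _ T%:R) // -normrM.
have /andP[fi0 _] := fr_itv i; have /andP[fj0 _] := fr_itv j.
have := truncn_bounds (mulr_ge0 fi0 (ler0n R T)).
have := truncn_bounds (mulr_ge0 fj0 (ler0n R T)).
have -> : Num.truncn (fr j * T%:R) = Num.truncn (fr i * T%:R).
  by move/(congr1 val): fij.
by move=> /andP[h1 h2] /andP[h3 h4]; rewrite ltr_norml; lra.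
Qed.

Lemma multiples_dense (h : R) : 0 < h -> forall t, exists2 j : nat,
  (j <= Num.truncn (2 / h))%N & exists z : int, `|j%:R * h - t - 2 * z%:~R| < h.
Proof.
move=> h0 t; have := floor_itv (t / 2); rewrite intrD => /andP[f1 f2].
set f := Num.floor _ in f1 f2; pose t' := t - 2 * f%:~R.
have t0 : 0 <= t' by rewrite /t'; lra.
have t2 : t' < 2 by rewrite /t'; lra.
exists (Num.truncn (t' / h)).
  by apply: le_truncn; rewrite ler_pM2r ?invr_gt0 //; apply: ltW.
exists (- f); have /andP[] := truncn_bounds (divr_ge0 t0 (ltW h0)).
rewrite ler_pdivlMr // ltr_pdivrMr //; move: (Num.truncn _) => n.
rewrite mulrDl mul1r /t' => h1 h2.
by rewrite intrN ltr_norml; lra.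
Qed.

(** Multiples of a short rotation [h] go around the circle in at most [2 / |h|] steps. One half of
    [e] bounds [|h|], the other the drift from [P0] to [P] over these steps. *)
Lemma dense_mod2 (e : R) : 0 < e -> exists S : nat, exists2 t : R, 0 < t &
  forall P, `|P - P0| < t -> forall x : R, exists2 i : nat, (i <= S)%N &
    exists z : int, `|P * i%:R - x - 2 * z%:~R| < e.
Proof.
move=> e0; have e20 : 0 < e / 2 by lra.
have [s [z [s0 hs]]] := dirichlet e20.
set h := P0 * s%:R - 2 * z%:~R in hs.
have h0 : h != 0.
  apply/eqP => h0; apply: (@irr s (2 * z)); first by rewrite -lt0n.
  by rewrite intrM; apply/eqP; rewrite -subr_eq0; apply/eqP.
have n0 : 0 < `|h| by rewrite normr_gt0.
pose S := (Num.truncn (2 / `|h|) * s)%N.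
exists S; exists (e / 2 / S.+1%:R); first by rewrite divr_gt0.
move=> P; rewrite ltr_pdivlMr // => hP x.
have [j hj [k hk]] : exists2 j : nat, (j <= Num.truncn (2 / `|h|))%N &
    exists k : int, `|j%:R * h - x - 2 * k%:~R| < `|h|.
  have [hp|hn] := leP 0 h;
    first by rewrite (ger0_norm hp); apply: multiples_dense; rewrite lt_neqAle eq_sym h0.
  have [j hj [k hk]] := multiples_dense n0 (- x).
  exists j => //; exists (- k); rewrite -normrN; move: hk.
  rewrite {1}(ltr0_norm hn); congr (_ < _); congr `|_|.
  by rewrite intrN; ring.
exists (j * s)%N; first by rewrite leq_mul2r hj orbT.
exists (j%:Z * z + k).
have -> : P * (j * s)%:R - x - 2 * (j%:Z * z + k)%:~R =
    (j%:R * h - x - 2 * k%:~R) + (P - P0) * (j * s)%:R.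
  by rewrite /h intrD intrM natrM -pmulrn; ring.
apply: le_lt_trans (ler_normD _ _) _.
have : `|(P - P0) * (j * s)%:R| <= `|P - P0| * S.+1%:R.
  rewrite normrM [`|(j * s)%:R|]ger0_norm // ler_wpM2l // ler_nat leqW //.
  by rewrite leq_mul2r hj orbT.
lra.
Qed.

End Diophantine.

(** * Relative density of good edges, uniformly near the limit *)

Section Density.
Variables (R : realType) (P0 : R).
Hypothesis irr : forall s z : int, s != 0 -> P0 * s%:~R <> z%:~R.
Hypothesis P01 : 0 < P0 < 1.

(* On the line [x = m], the P- and Q-lines through a unit edge have intercepts
   differing by the fixed amount [2 m + 1 - 2 top m]; letting the P-line approach
   the right end of the lit interval makes it light and the Q-line dark. *)
Lemma vgood_on_column (e : R) : 0 < e -> exists S : nat, exists2 t : R, 0 < t &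
  forall p q, even_param p q -> `|bigP R p q - P0| < t -> forall m y0 : int,
  4 * e <= `|mod2 (2 * bigP R p q * m%:~R)| < 1 ->
  4 * e <= `|mod2 (bigP R p q * (2 * m + 1 - 2 * top R p q m)%:~R)| ->
  exists2 i : nat, (i <= S)%N & vgood R p q m (y0 + i%:Z).
Proof.
move=> e0; have [S [t t0 hS]] := dense_mod2 irr e0.
exists S; exists t => // p q pq hP m y0; set P := bigP R p q in hP *.
set G := 2 * P * m%:~R; set g := mod2 G => /andP[g4 g1].
set a := top _ _ _ _; set D := P * _; set d := mod2 D => d4.
(* The target lies between 0 and [g], at distance [2 e] from the end towards which [d] points. An
   error below [e] keeps the P-line light, while adding [d], of modulus at least [4 e], leaves the
   interval. *)
pose f0 : R := if 0 < g then if 0 < d then g - 2 * e else 2 * e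
               else if 0 < d then - (2 * e) else g + 2 * e.
have [i iS [z hz]] := hS P hP (f0 - (P * (y0 + a)%:~R + 1)).
exists i => //; rewrite /vgood /lit -/P -/a -/G.
have -> : y0 + i%:Z + 2 * m + 1 - a = y0 + i%:Z + a + (2 * m + 1 - 2 * a) by ring.
set F := P * (y0 + i%:Z + a)%:~R + 1.
have -> : P * (y0 + i%:Z + a + (2 * m + 1 - 2 * a))%:~R + 1 = F + D.
  by rewrite /F [(_ + a + _)%:~R]intrD /D; ring.
pose f := F - 2 * z%:~R.
have hf : `|f - f0| < e.
  move: hz; congr (`|_| < _); rewrite /f /F !intrD -pmulrn; ring.
have eF : F = f + 2 * z%:~R by rewrite /f subrK.
have [k hk] := mod2E D; have d1 := mod2_itv D; rewrite -/d in hk d1.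
have eFD : F + D = (f + d) + 2 * (z + k)%:~R by rewrite eF {1}hk intrD; ring.
rewrite /between -/g eFD eF !mod2D.
move: hf g4 g1 d4; rewrite /f0 ltr_distl; clear -e0 d1; clearbody f g d.
have [gp|gn] := ltP 0 g; have [dp|dn] := ltP 0 d.
- rewrite !gtr0_norm // => /andP[h1 h2] g4 g1 d4.
  rewrite (@mod2_unique _ f f 0) ?mulr0 ?addr0 //; last by lra.
  have -> : (g < f) = false by apply/negbTE; rewrite -leNgt; lra.
  have -> : 0 < f by lra.
  have [fd|fd] := leP (f + d) 1.
    rewrite (@mod2_unique _ _ (f + d) 0) ?mulr0 ?addr0 //; last by lra.
    have -> : g < f + d by lra.
    by have -> : 0 < f + d by lra.
  rewrite (@mod2_unique _ _ (f + d - 2) 1); [|lra|lra].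
  have -> : (g < f + d - 2) = false by apply/negbTE; rewrite -leNgt; lra.
  by have -> : (0 < f + d - 2) = false by apply/negbTE; rewrite -leNgt; lra.
- rewrite gtr0_norm // ler0_norm // => /andP[h1 h2] g4 g1 d4.
  rewrite (@mod2_unique _ f f 0) ?mulr0 ?addr0 //; last by lra.
  have -> : (g < f) = false by apply/negbTE; rewrite -leNgt; lra.
  have -> : 0 < f by lra.
  rewrite (@mod2_unique _ _ (f + d) 0) ?mulr0 ?addr0 //; last by lra.
  have -> : (g < f + d) = false by apply/negbTE; rewrite -leNgt; lra.
  by have -> : (0 < f + d) = false by apply/negbTE; rewrite -leNgt; lra.
- rewrite ler0_norm // gtr0_norm // => /andP[h1 h2] g4 g1 d4.
  rewrite (@mod2_unique _ f f 0) ?mulr0 ?addr0 //; last by lra.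
  have -> : g < f by lra.
  have -> : (0 < f) = false by apply/negbTE; rewrite -leNgt; lra.
  rewrite (@mod2_unique _ _ (f + d) 0) ?mulr0 ?addr0 //; last by lra.
  have -> : g < f + d by lra.
  by have -> : 0 < f + d by lra.
- rewrite !ler0_norm // => /andP[h1 h2] g4 g1 d4.
  rewrite (@mod2_unique _ f f 0) ?mulr0 ?addr0 //; last by lra.
  have -> : g < f by lra.
  have -> : (0 < f) = false by apply/negbTE; rewrite -leNgt; lra.
  have [fd|fd] := leP (f + d) (-1).
    rewrite (@mod2_unique _ _ (f + d + 2) (-1)); [|lra|rewrite intrN; lra].
    have -> : g < f + d + 2 by lra.
    by have -> : 0 < f + d + 2 by lra.
  rewrite (@mod2_unique _ _ (f + d) 0) ?mulr0 ?addr0 //; last by lra.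
  have -> : (g < f + d) = false by apply/negbTE; rewrite -leNgt; lra.
  by have -> : (0 < f + d) = false by apply/negbTE; rewrite -leNgt; lra.
Qed.

(** Two adjacent columns with equal [top] are considered. Their shifts between P-line and Q-line
    differ by [2 P], which is far from 0 modulo 2, so at least one column satisfies the hypotheses
    of [vgood_on_column]. *)
Lemma vgood_dense : exists L : nat, exists2 t : R, 0 < t &
  forall p q, even_param p q -> `|bigP R p q - P0| < t -> forall x0 y0 : int,
  exists m n : int, [/\ x0 < m < x0 + L%:Z, y0 <= n < y0 + L%:Z & vgood R p q m n].
Proof.
pose e : R := Num.min P0 (1 - P0) / 8.
have e0 : 0 < e.
  have /andP[P0gt P0lt] := P01; rewrite /e divr_gt0 // lt_min P0gt; lra.
have eP : 8 * e <= P0.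
  by rewrite /e mulrC divfK // ge_min lexx.
have eP' : 8 * e <= 1 - P0.
  by rewrite /e mulrC divfK // ge_min lexx orbT.
have [S [t t0 hS]] := vgood_on_column e0.
have [S' [t' t'0 hS']] := dense_mod2 irr e0.
exists (S + S').+3; exists (Num.min e (Num.min t t')); first by rewrite !lt_min e0 t0.
move=> p q pq; set P := bigP R p q.
rewrite !lt_min => /and3P[he ht ht'] x0 y0.
(* This target puts [P m] and [P (m + 1)] nearly symmetrically about 1/2 modulo 2. Both then have
   the same [top], and doubled they are close to [1 - P0] and [P0 - 1] modulo 2. *)
have [i iS' [z hz]] := hS' P ht' ((1 - P0) / 2 - P * (x0 + 1)%:~R).
pose m := x0 + 1 + i%:Z; pose phi := P * m%:~R - 2 * z%:~R.
have hphi : `|phi - (1 - P0) / 2| < e.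
  move: hz; congr (`|_| < _); rewrite /phi /m [(x0 + 1 + _)%:~R]intrD -pmulrn; ring.
move: hphi he; rewrite !ltr_distl => /andP[f1 f2] /andP[p1 p2].
have ePm : P * m%:~R = 2 * z%:~R + phi by rewrite /phi; ring.
have ePm1 : P * (m + 1)%:~R = 2 * z%:~R + phi + P by rewrite intrD mulrDr ePm; ring.
have top1 : top R p q m = 2 * z + 1.
  apply: top_unique; rewrite -/P ePm intrD intrM. lra.
have top2 : top R p q (m + 1) = 2 * z + 1.
  by apply: top_unique; rewrite -/P ePm1 intrD intrM; lra.
suff [m' hm' [g4 d4]] : exists2 m' : int, (m' = m \/ m' = m + 1) &
    4 * e <= `|mod2 (2 * P * m'%:~R)| < 1 /\
    4 * e <= `|mod2 (P * (2 * m' + 1 - 2 * top R p q m')%:~R)|.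
  have [j jS hj] := hS p q pq ht m' y0 g4 d4.
  exists m', (y0 + j%:Z); split=> //; last by clear -jS; lia.
  by move: hm'; rewrite /m; clear -iS'; lia.
set D := P * (2 * m + 1 - 2 * top R p q m)%:~R.
have [k hk] := mod2E D; have d1 := mod2_itv D.
have [d4|d4] := leP (4 * e) `|mod2 D|.
  exists m; first by left.
  split=> //; rewrite (@mod2_unique _ _ (2 * phi) (2 * z)); [|lra|].
    by rewrite gtr0_norm; lra.
  by rewrite -mulrA ePm intrM; ring.
exists (m + 1); first by right.
split.
  rewrite (@mod2_unique _ _ (2 * phi + 2 * P - 2) (2 * z + 1)); [|lra|].
    by rewrite ltr0_norm; lra.
  by rewrite -mulrA ePm1 intrD intrM; ring.
have -> : P * (2 * (m + 1) + 1 - 2 * top R p q (m + 1))%:~R = D + 2 * P.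
  by rewrite top2 -top1 /D !intrB !intrD !intrM; ring.
move: d4; rewrite ltr_norml => /andP[d3 d4].
have eD : D + 2 * P = mod2 D + 2 * P + 2 * k%:~R by rewrite {1}hk; ring.
have [hb|hb] := leP (mod2 D + 2 * P) 1.
  rewrite (@mod2_unique _ _ (mod2 D + 2 * P) k) //; last by lra.
  by rewrite gtr0_norm; lra.
rewrite (@mod2_unique _ _ (mod2 D + 2 * P - 2) (k + 1)).
- by rewrite ltr0_norm; lra.
- by lra.
- by rewrite eD intrD; ring.
Qed.

End Density.

(** * Lines of small capacity *)

Section LevelLines.
Variables (R : realType) (p q : nat).
Hypothesis pq : even_param p q.
Notation w := (p + q)%N.
Notation P := (bigP R p q).

(** With [half_cap_min] this identifies the half capacity as [w] times the distance from [P x] to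
    the nearest integer, the link to Diophantine approximation. *)
Lemma half_cap_dist (x : nat) : exists z : int,
  w%:R * `|P * x%:R - z%:~R| = (half_cap p q x)%:R.
Proof.
have [z hz] := mod2E (2 * P * x%:Z%:~R); exists z.
have -> : P * x%:R - z%:~R = mod2 (2 * P * x%:Z%:~R) / 2.
  by move: hz; rewrite -pmulrn -mulrA; set u := P * _; lra.
rewrite normrM -[X in X * _]gtr0_norm ?(w_gt0 R pq) // mulrA -normrM mod2_line //.
have sg : `|(cap_sign p q x)%:~R| = 1 :> R.
  by rewrite /cap_sign; case: ifP => _; rewrite ?intrN ?normrN; exact: normr1.
have -> : `|(2 * cap_sign p q x * (half_cap p q x)%:Z)%:~R| = 2 * (half_cap p q x)%:R :> R.
  by rewrite !intrM !normrM sg mulr1 -pmulrn !ger0_norm.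
by rewrite ger0_norm ?invr_ge0 //; field.
Qed.

Lemma half_cap_min (x : nat) (z : int) :
  (half_cap p q x)%:R <= w%:R * `|P * x%:R - z%:~R|.
Proof.
have [k hk] := half_cap_dist x; have [->|kz] := eqVneq z k; first by rewrite hk.
have w0 := w_gt0 R pq; rewrite -hk ler_pM2l //.
have hle : `|P * x%:R - k%:~R| <= 1 / 2.
  rewrite -(ler_pM2l w0) hk.
  have : (2 * half_cap p q x <= w)%N.
    by have [_ _ _ od _] := even_paramP pq; rewrite /half_cap; clear; lia.
  by rewrite -(ler_nat R) natrM; lra.
have : 1 <= `|k%:~R - z%:~R : R|.
  by rewrite -intrB -intr_norm (ler_int R 1); clear -kz; lia.
have := ler_normB (P * x%:R - z%:~R) (P * x%:R - k%:~R).
have -> : P * x%:R - z%:~R - (P * x%:R - k%:~R) = k%:~R - z%:~R by ring.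
lra.
Qed.


Lemma half_cap_w : half_cap p q w = 0%N.
Proof. by rewrite /half_cap modnMl min0n. Qed.

Lemma half_cap_0 : half_cap p q 0 = 0%N.
Proof. by rewrite /half_cap muln0 mod0n min0n. Qed.

Variable K : nat.
Hypothesis K2 : (2 * K < w)%N.

Definition level_lines : seq nat := [seq x <- iota 0 w | (half_cap p q x <= K)%N].
(* the default value makes [level_line (size level_lines) = w] *)
Definition level_line (i : nat) : nat := nth w level_lines i.

Lemma level_line_size : level_line (size level_lines) = w.
Proof. by rewrite /level_line nth_default. Qed.

Lemma mem_level_lines x : (x \in level_lines) = (half_cap p q x <= K)%N && (x < w)%N.
Proof. by rewrite mem_filter mem_iota. Qed.

Lemma level_line_mem i : (i < size level_lines)%N ->
  (half_cap p q (level_line i) <= K)%N && (level_line i < w)%N.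
Proof. by move=> h; rewrite -mem_level_lines mem_nth. Qed.

Lemma level_line_low i : (i <= size level_lines)%N -> (half_cap p q (level_line i) <= K)%N.
Proof.
rewrite leq_eqVlt => /orP[/eqP->|/level_line_mem/andP[]//].
by rewrite level_line_size half_cap_w.
Qed.

Lemma level_lines_sorted : sorted ltn level_lines.
Proof. by apply: sorted_filter; [exact: ltn_trans|exact: iota_ltn_sorted]. Qed.

Lemma level_line_lt i : (i < size level_lines)%N -> (level_line i < level_line i.+1)%N.
Proof.
move=> h; move: (h); rewrite leq_eqVlt => /orP[/eqP e|h1].
  by rewrite e level_line_size; case/andP: (level_line_mem h).
by apply: (sorted_ltn_nth ltn_trans w level_lines_sorted).
Qed.

Lemma level_line_le i : (level_line i <= w)%N.
Proof.
have [h|h] := ltnP i (size level_lines); last by rewrite /level_line nth_default.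
by apply: ltnW; case/andP: (level_line_mem h).
Qed.

Lemma level_line_gap i x : (i < size level_lines)%N -> (level_line i < x < level_line i.+1)%N ->
  (K < half_cap p q x)%N.
Proof.
move=> h /andP[h1 h2]; rewrite ltnNge; apply/negP => low.
have xw : (x < w)%N by apply: leq_trans (level_line_le i.+1).
have xl : x \in level_lines by rewrite mem_level_lines low.
have jl : (index x level_lines < size level_lines)%N by rewrite index_mem.
move: h1 h2; rewrite -(nth_index w xl) => h1 h2.
have mono := sorted_leq_nth leq_trans leqnn w
  (sub_sorted (fun _ _ => @ltnW _ _) level_lines_sorted).
have [ij|ji] := ltnP i (index x level_lines).
  have := mono i.+1 (index x level_lines) _ jl ij.
  rewrite inE => /(_ (leq_ltn_trans ij jl)).
  by rewrite leqNgt h2.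
have := mono (index x level_lines) i jl h ji.
by rewrite leqNgt h1.
Qed.

Lemma level_line0 : level_line 0 = 0%N.
Proof.
have [_ _ _ od _] := even_paramP pq.
rewrite /level_line /level_lines; case: (w) od half_cap_0 => //= n _ h0.
by rewrite /half_cap muln0 mod0n min0n.
Qed.

Lemma sum_level_lines (F : nat -> nat) :
  (\sum_(i < size level_lines) F (level_line i) =
   \sum_(x < w | (half_cap p q x <= K)%N) F x)%N.
Proof.
rewrite -(big_mkord xpredT (fun i => F (level_line i))) -(big_nth w xpredT F).
by rewrite big_filter -[iota 0 w]/(iota 0 w) -{1}(subn0 w) -/(index_iota 0 w) big_mkord.
Qed.

Lemma level_rectangle : exists i j, [/\ (i < size level_lines)%N, (j < size level_lines)%N,
    forall y, (level_line j <= y < level_line j.+1)%N ->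
      vgood R p q (level_line i) y = false /\ vgood R p q (level_line i.+1) y = false &
    forall x, (level_line i <= x < level_line i.+1)%N ->
      hgood R p q x (level_line j) = false /\ hgood R p q x (level_line j.+1) = false].
Proof.
pose V (x y : nat) := vgood R p q x y; pose H (x y : nat) := hgood R p q x y.
have S1 (n : nat) : n%:Z + 1 = n.+1 by rewrite -addn1.
have dv (c : int) : lit R p q w c = false by rewrite lit0.
have d0 (c : int) : lit R p q 0 c = false by rewrite lit0.
apply: (@uncrossed_rectangle w V H _ (size level_lines) level_line).
- move=> x y _ _; rewrite /V /H -!S1; exact: square_even.
- exact: level_line0.
- exact: level_line_size.
- by move=> i /level_line_lt /ltnW.
- by move=> y; rewrite /V /vgood !d0.
- by move=> y; rewrite /V /vgood !dv.
- by move=> x; rewrite /H /hgood !d0 if_same.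
- by move=> x; rewrite /H /hgood !dv if_same.
have r2 : (size level_lines = \sum_(x < w | (half_cap p q x <= K)%N) 1)%N.
  by rewrite -(sum_level_lines (fun=> 1%N)) sum1_card card_ord.
have := few_crossings pq K2; rewrite -r2; apply: leq_ltn_trans.
rewrite mul2n -addnn -(sum_level_lines (fun x => 2 * half_cap p q x)%N).
apply: leq_add; apply: leq_sum => i _; first exact: vgood_count.
exact: hgood_count.
Qed.

End LevelLines.

(** * Polygons in a block *)

Section Block.
Variables (R : realType) (p q : nat) (a b : int).
Hypothesis pq : even_param p q.
Notation w := (p + q)%N.
Notation P := (bigP R p q).
Notation X := (w%:Z * (w%:Z * a)).
Notation Y := (w%:Z * b).

Lemma good_vgood_shift (m n : int) :
  good R p q (USeg Ver (X + m) (Y + n)) <-> vgood R p q m n.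
Proof. by rewrite good_vgood // addrC [Y + n]addrC vgood_shift. Qed.

Lemma good_hgood_shift (m n : int) :
  good R p q (USeg Hor (X + m) (Y + n)) <-> hgood R p q m n.
Proof. by rewrite good_hgood // addrC [Y + n]addrC hgood_shift. Qed.

Lemma uncrossed_shift (x y c d : nat) :
  (forall n, (y <= n < y + d)%N ->
     vgood R p q x n = false /\ vgood R p q (x + c)%N n = false) ->
  (forall m, (x <= m < x + c)%N ->
     hgood R p q m y = false /\ hgood R p q m (y + d)%N = false) ->
  uncrossed R p q (X + x%:Z) (X + (x + c)%N%:Z) (Y + y%:Z) (Y + (y + d)%N%:Z).
Proof.
move=> hV hH; split=> k hk.
  have [n -> hn] : exists2 n : nat, k = Y + n%:Z & (y <= n < y + d)%N.
    by exists `|k - Y|%N; clear -hk; lia.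
  by have [h1 h2] := hV n hn; rewrite !good_vgood_shift h1 h2.
have [m -> hm] : exists2 m : nat, k = X + m%:Z & (x <= m < x + c)%N.
  by exists `|k - X|%N; clear -hk; lia.
by have [h1 h2] := hH m hm; rewrite !good_hgood_shift h1 h2.
Qed.

Lemma block_box : block p q a b = @box R X (X + w%:Z) Y (Y + w%:Z).
Proof.
have eX : a%:~R * omega R p q ^+ 2 = X%:~R by rewrite /omega !intrM -pmulrn; ring.
have eY : b%:~R * omega R p q = Y%:~R by rewrite /omega !intrM -pmulrn; ring.
by rewrite /block /box eX eY !(intrD _ _ w%:Z).
Qed.

Lemma lit_border (c : int) : lit R p q 0 c = false /\ lit R p q w c = false.
Proof. by rewrite !lit0. Qed.

Lemma block_uncrossed : uncrossed R p q (X + 0) (X + w%:Z) (Y + 0) (Y + w%:Z).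
Proof.
have := @uncrossed_shift 0 0 w w; rewrite add0n; apply=> n _.
  by rewrite /vgood !(lit_border _).1 !(lit_border _).2.
by rewrite /hgood !(lit_border _).1 !(lit_border _).2 !if_same.
Qed.

Lemma plaid_polygon_in_block C z : @plaid_polygon R p q C -> C z ->
  block p q a b z -> C `<=` block p q a b.
Proof.
rewrite block_box => hC Cz; have := block_uncrossed; rewrite !addr0 => uc.
exact: (plaid_polygon_confined uc hC Cz).
Qed.

(* Choosing [m < w / 2] among the two lines of capacity 2 in the block. *)
Lemma capacity_two : exists m : nat, [/\ (0 < m)%N, (2 * m < w)%N &
  forall c : int, lit R p q m c = (w%:Z %| c - m%:Z)%Z].
Proof.
have [p0 lpq cop od w2] := even_paramP pq.
have w0 : (0 < w)%N by lia.
have [m [m0 mw hc hd]] : exists m : nat, [/\ (0 < m)%N, (2 * m < w)%N,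
    half_cap p q m = 1%N &
    ((2 * w)%:Z %| 2 * p%:Z * m%:Z + w%:Z - cap_sign p q m)%Z].
  (* Modulo [w] one has [2 p v = -1], so [v] and [w - v] are the two lines of capacity 2, and one of
     them is below [w / 2]. *)
  have [v vw] := Bezoutl (2 * p) w0.
  have -> : gcdn w (2 * p) = 1%N.
    by apply/eqP; rewrite -/(coprime w (2 * p)) coprimeMr coprimen2 od coprime_sym.
  move=> /dvdnP[k hk].
  have ok : odd k.
    have : odd (k * w) by rewrite -hk mulnCA oddD oddM.
    by rewrite oddM od andbT.
  have v0 : (0 < v)%N.
    rewrite lt0n; apply/eqP => e; move: hk; rewrite e mul0n addn0 => /esym/eqP.
    by rewrite muln_eq1; clear -w2; lia.
  have k0 : (0 < k)%N by clear -ok; lia.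
  have [lt|ge] := ltnP (2 * v) w.
    have u : ((2 * p * v) %% w = w.-1)%N.
      have -> : (2 * p * v = k.-1 * w + w.-1)%N.
        move: hk; rewrite -{1}(prednK k0) mulSn; move: (k.-1) => k'.
        by clear -w0; nia.
      by rewrite modnMDl modn_small //; clear -w2; lia.
    exists v; split=> //; rewrite /half_cap /cap_sign u; first by clear -w2; lia.
    rewrite ifF; last by clear -w2; lia.
    apply/dvdzP; exists (k.+1./2)%:Z.
    have e : (k.+1 = 2 * k.+1./2)%N by clear -ok; lia.
    by clear -e hk; nia.
  have vodd : (w < 2 * v)%N.
    by rewrite ltn_neqAle ge andbT; apply: contraL od => /eqP ->; rewrite oddM.
  have k2p : (k <= 2 * p)%N by clear -hk vw w2 p0; nia.
  have u : ((2 * p * (w - v)) %% w = 1)%N.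
    have -> : (2 * p * (w - v) = (2 * p - k) * w + 1)%N.
      by rewrite mulnBr mulnBl; clear -hk vw k2p; nia.
    by rewrite modnMDl modn_small //; clear -w2; lia.
  exists (w - v)%N; split; rewrite ?/half_cap ?/cap_sign ?u; try by clear -w2 vw vodd; lia.
  rewrite ifT; last by clear -w2; lia.
  apply/dvdzP; exists (p%:Z - (k.-1./2)%:Z).
  have e : (k = 2 * k.-1./2 + 1)%N by clear -ok; lia.
  rewrite PoszM -subzn; last exact: ltnW.
  have hz : 1 + v%:Z * (2 * p%:Z) = k%:Z * w%:Z by clear -hk; lia.
  have {}e : k%:Z = 2 * (k.-1./2)%:Z + 1 by clear -e; lia.
  rewrite mulrBr; have -> : 2 * p%:Z * v%:Z = k%:Z * w%:Z - 1 by rewrite -hz; ring.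
  by rewrite {1}e; ring.
exists m; split=> // c.
have dvd2 : ((2 * w)%:Z %| 2 * p%:Z * c + w%:Z - cap_sign p q m)%Z =
    (w%:Z %| c - m%:Z)%Z.
  have -> : 2 * p%:Z * c + w%:Z - cap_sign p q m =
      2 * (p%:Z * (c - m%:Z)) + (2 * p%:Z * m%:Z + w%:Z - cap_sign p q m) by ring.
  rewrite rpredDr // PoszM dvdz_mul2l // Gauss_dvdzr //.
  by rewrite coprimezE /= coprime_sym.
rewrite -dvd2; apply/idP/idP.
  by case/(lit_residue R pq) => s; rewrite hc ltnS leqn0 => /eqP ->; rewrite mulr0 add0r mulr1.
by move=> h; apply/(lit_residue R pq); exists 0%N; rewrite ?hc // mulr0 add0r mulr1.
Qed.

(* Left of [x = m] every square has an even number of good edges, so the two good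
   edges on [x = m] are linked there. *)
Lemma tall_polygon : exists C : set (R * R), [/\ @plaid_polygon R p q C,
  C `<=` block p q a b & exists z v, [/\ C z, C v & (2 * p%:R - 1) <= dist2 z v]].
Proof.
have [p0 lpq cop od w2] := even_paramP pq.
have [m [m0 mw hm]] := capacity_two.
pose e := ((2 * p * m) %/ w)%N.
have em : (e < m)%N by rewrite /e ltn_divLR; clear -m0 lpq; nia.
have em' : (2 * p * m < e.+1 * w)%N by rewrite -ltn_divLR //; clear -w2; lia.
(* The P-line of intercept [m] crosses the line [x = m] in edge [n1], the Q-line of intercept
   [m + w] in edge [n2]; the symmetry is [n1 + n2 = w - 1]. *)
pose n1 := (m - 1 - e)%N; pose n2 := (w + e - m)%N.
have top_m : top R p q m = e%:Z + 1 by exact: topE.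
have vg (n : nat) : (n < w)%N -> vgood R p q m n = (n == n1) || (n == n2).
  move=> nw; rewrite /vgood !hm top_m.
  have small (x y : nat) : (x < w)%N -> (y < w)%N -> (w%:Z %| x%:Z - y%:Z)%Z = (x == y).
    move=> xw yw; apply/idP/eqP => [/dvdzP[k hk]|->]; last by rewrite subrr dvdz0.
    have : k = 0.
      have [h1 h2] : - w%:Z < k * w%:Z /\ k * w%:Z < w%:Z.
        by rewrite -hk; clear -xw yw; lia.
      by clear -h1 h2; move: (w%:Z) h1 h2 => B; nia.
    by move=> k0; move: hk; rewrite k0 mul0r; clear; lia.
  have -> : n%:Z + (e%:Z + 1) - m%:Z = n%:Z - n1%:Z by rewrite /n1; clear -em; lia.
  have -> : n%:Z + 2 * m%:Z + 1 - (e%:Z + 1) - m%:Z = n%:Z - n2%:Z + w%:Z.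
    by rewrite /n2; clear -em mw; lia.
  rewrite [(_ %| _ + w%:Z)%Z]rpredDr ?dvdzz // !small //; last 2 first.
  - by rewrite /n2; clear -em mw; lia.
  - by rewrite /n1; clear -em mw; lia.
  have n12 : n1 != n2 by rewrite /n1 /n2; clear -em mw; lia.
  by case: eqVneq => [->|_] //=; rewrite (negbTE n12).
have n1w : (n1 < w)%N by rewrite /n1; clear -em mw; lia.
have n2w : (n2 < w)%N by rewrite /n2; clear -em mw; lia.
pose edge (n : nat) := USeg Ver (X + m%:Z) (Y + n%:Z).
have ge (n : nat) : (n == n1) || (n == n2) -> (n < w)%N -> good R p q (edge n).
  by move=> h nw; rewrite good_vgood_shift vg.
have left_sq (n : nat) : square_edge (X + m.-1%:Z) (Y + n%:Z) (edge n).
  by right; right; right; rewrite /edge; congr USeg; clear -m0; lia.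
pose C := connected_component (@plaid_union R p q) (seg_mid R (edge n1)).
have g1 : good R p q (edge n1) by apply: ge; rewrite ?eqxx.
have hC : @plaid_polygon R p q C by exact: (plaid_polygon_good g1 (left_sq n1)).
have C1 : C (seg_mid R (edge n1)).
  apply: connected_component_refl; exists (X + m.-1%:Z), (Y + n1%:Z), (edge n1).
  by split=> //; split=> //; exact: segment_right.
pose W (x y : nat) := `[< C (sq_center R (X + x%:Z) (Y + y%:Z)) >].
have link s x y x' y' : good R p q s -> square_edge (X + x%:Z) (Y + y%:Z) s ->
    square_edge (X + x'%:Z) (Y + y'%:Z) s -> W x y = W x' y'.
  move=> gs h h'; apply: asbool_equiv_eq.
  exact: (iff_trans (plaid_polygon_edge hC gs h) (iff_sym (plaid_polygon_edge hC gs h'))).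
have S1 (n : nat) : n%:Z + 1 = n.+1 by rewrite -addn1.
have even_left : ~~ odd (\sum_(y < w) (W m.-1 y && vgood R p q m.-1.+1 y)).
  apply: (@handshake w (fun x y => vgood R p q x y) (fun x y => hgood R p q x y) _ W m.-1).
  - by move=> x y _ _; rewrite -!S1; exact: square_even.
  - by clear -mw; lia.
  - by move=> y; rewrite /vgood !(lit_border _).1.
  - by move=> x; rewrite /hgood !(lit_border _).1 if_same.
  - by move=> x; rewrite /hgood !(lit_border _).2 if_same.
  - move=> x y _ _ /good_vgood_shift gs; apply: (link _ _ _ _ _ gs).
      by right; right; right; rewrite -S1 addrA.
    by right; right; left.
  - move=> x y _ _ /good_hgood_shift gs; apply: (link _ _ _ _ _ gs).
      by right; left; rewrite -S1 addrA.
    by left.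
have W1 : W m.-1 n1.
  by apply/asboolP; apply/(plaid_polygon_edge hC g1 (left_sq n1)).
have W2 : W m.-1 n2.
  apply: contraNT even_left => nW2.
  rewrite (eq_bigr (fun y : 'I_w => nat_of_bool (val y == n1))); last first.
    move=> y _; rewrite (prednK m0) vg //; congr nat_of_bool.
    case: eqVneq => [->|_] /=; first by rewrite W1.
    by case: eqVneq => [->|_] /=; rewrite ?andbF // (negbTE nW2).
  rewrite (bigD1 (Ordinal n1w)) //= eqxx big1 // => y.
  by rewrite -val_eqE /= => /negbTE ->.
have g2 : good R p q (edge n2) by apply: ge; rewrite ?eqxx ?orbT.
have C2 : C (seg_mid R (edge n2)).
  by apply/(plaid_polygon_edge hC g2 (left_sq n2)); apply/asboolP.
exists C; split=> //.
  apply: (plaid_polygon_in_block hC C1); rewrite block_box /box /= !intrD.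
  have hmw : m%:Z%:~R <= w%:Z%:~R :> R by rewrite ler_int; clear -mw; lia.
  have hn1 : n1%:Z%:~R + 1 <= w%:Z%:~R :> R.
    by rewrite -[1]/(1%:~R) -intrD ler_int; clear -n1w; lia.
  have h0 : 0 <= m%:Z%:~R :> R by rewrite ler0z.
  have h1 : 0 <= n1%:Z%:~R :> R by rewrite ler0z.
  by split; lra.
exists (seg_mid R (edge n1)), (seg_mid R (edge n2)); split=> //.
rewrite /dist2 /= subrr expr0n add0r sqrtr_sqr !intrD.
have -> : Y%:~R + n1%:Z%:~R + 2^-1 - (Y%:~R + n2%:Z%:~R + 2^-1) =
  n1%:R - n2%:R :> R by rewrite -!pmulrn; ring.
(* The height is [w + 2 e + 1 - 2 m]. It is bounded below by [(e + 1) w > 2 p m] and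
   [(w - 2 p) (w - 2 m) >= 0]. *)
have : (2 * p + n1 <= n2 + 1)%N.
  have : (2 * m + 2 * p <= 2 * e.+1 + w)%N.
    have w0 : (0 < w)%N by clear -w2; lia.
    have hcd : 0 <= (w%:Z - 2 * p%:Z) * (w%:Z - 2 * m%:Z).
      by apply: mulr_ge0; clear -lpq mw; lia.
    rewrite -(leq_pmul2r w0); clear -em' hcd.
    by move: (w) em' hcd => W em' hcd; lia.
  by rewrite /n1 /n2; clear -em mw; lia.
rewrite -(ler_nat R) (natrD _ (2 * p)) (natrD _ n2) (natrM _ 2) distrC => h.
by apply: le_trans (ler_norm _); lra.
Qed.

End Block.

(** * Rectangles at many scales *)

Section Scales.
Variables (R : realType) (P0 : R).
Hypothesis irr : forall s z : int, s != 0 -> P0 * s%:~R <> z%:~R.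
Hypothesis P01 : 0 < P0 < 1.

(* Take all grid lines [i] with [P i] within [d / 4] of an integer: consecutive ones
   are more than [M] apart, and the gaps are bounded since [P0] is irrational. *)
Lemma bounded_rectangle (M : nat) : exists S : nat, exists2 t : R, 0 < t &
  forall p q, even_param p q -> `|bigP R p q - P0| < t ->
  exists x y c d : nat, [/\ (M < c <= S)%N /\ (M < d <= S)%N,
    (x + c <= p + q)%N /\ (y + d <= p + q)%N,
    forall n, (y <= n < y + d)%N ->
      vgood R p q x n = false /\ vgood R p q (x + c)%N n = false &
    forall m, (x <= m < x + c)%N ->
      hgood R p q m y = false /\ hgood R p q m (y + d)%N = false].
Proof.
have [d d0 [t t0 hd]] := away_from_int irr M.+1.
have d4 : 0 < d / 4 by lra.
have [S [t' t'0 hS]] := dense_mod2 irr d4.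
exists S.+1; exists (Num.min t t'); first by rewrite lt_min t0.
move=> p q pq; rewrite lt_min => /andP[ht ht'].
set P := bigP R p q in ht ht'; have w0 := w_gt0 R pq.
pose w := (p + q)%N; rewrite -/w in w0.
have /andP[Pgt0 Plt1] := bigP_itv R pq.
(* The case of multiplier 1 and integer 0 gives [d <= P]; this ensures [2 K < w] below. *)
have dlt1 : d < 1.
  have := hd P ht 1%N 0 isT; rewrite mulr1 subr0 gtr0_norm //.
  by move/le_lt_trans; apply.
have dw0 : 0 <= d / 4 * w%:R by rewrite mulr_ge0 ?ltW.
pose K := Num.truncn (d / 4 * w%:R).
have /andP[K1 K2] := truncn_bounds dw0; rewrite -/K in K1 K2.
have Kw : (2 * K < w)%N.
  rewrite -(ltr_nat R) natrM; apply: (@le_lt_trans _ _ (d / 2 * w%:R)); first by lra.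
  by rewrite -[ltRHS]mul1r ltr_pM2r //; lra.
have low_dist x : (half_cap p q x <= K)%N ->
    exists z : int, `|P * x%:R - z%:~R| <= d / 4.
  move=> xK; have [z hz] := half_cap_dist R pq x; exists z.
  rewrite -(ler_pM2l w0) hz; apply: (@le_trans _ _ K%:R); first by rewrite ler_nat.
  by rewrite [leRHS]mulrC.
pose s := level_line p q K; pose r := size (level_lines p q K).
have gap i : (i < r)%N -> (M < s i.+1 - s i <= S.+1)%N.
  move=> ir; have lt := level_line_lt ir; rewrite -/(s i) -/(s i.+1) in lt.
  apply/andP; split.
    rewrite ltnNge; apply/negP => small.
    have [z1 h1] := low_dist _ (level_line_low (ltnW ir)).
    have [z2 h2] := low_dist _ (level_line_low ir).
    have hs : (0 < s i.+1 - s i <= M.+1)%N by rewrite subn_gt0 lt leqW.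
    have := hd P ht _ (z2 - z1) hs; rewrite natrB ?(ltnW lt) //.
    have -> : P * ((s i.+1)%:R - (s i)%:R) - (z2 - z1)%:~R =
      (P * (s i.+1)%:R - z2%:~R) - (P * (s i)%:R - z1%:~R) by rewrite intrB; ring.
    have := ler_normB (P * (s i.+1)%:R - z2%:~R) (P * (s i)%:R - z1%:~R).
    by rewrite -/(s i) in h1; rewrite -/(s i.+1) in h2; lra.
  rewrite leqNgt; apply/negP => large.
  have [j jS [z hz]] := hS P ht' (- (P * (s i).+1%:R)).
  have hx : (s i < (s i).+1 + j < s i.+1)%N.
    by move: large jS; clear; move: (s i) (s i.+1) => u v; lia.
  have := level_line_gap ir hx; rewrite ltnNge => /negP[].
  rewrite /K truncn_ge_nat //.
  apply: le_trans (half_cap_min R pq _ (2 * z)) _.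
  rewrite mulrC ler_pM2r // intrM natrD.
  move: hz; have -> : P * j%:R - - (P * (s i).+1%:R) - 2 * z%:~R =
    P * ((s i).+1%:R + j%:R) - 2 * z%:~R by ring.
  exact: ltW.
have [i [j [ir jr hv hh]]] := level_rectangle R pq Kw.
have hi := ltnW (level_line_lt ir); have hj := ltnW (level_line_lt jr).
exists (s i), (s j), (s i.+1 - s i)%N, (s j.+1 - s j)%N.
split; [by split; apply: gap| |by rewrite !subnKC|by rewrite !subnKC].
by rewrite !subnKC //; split; apply: level_line_le.
Qed.

Fixpoint avoid_bound (S L n : nat) : nat :=
  if n is n'.+1 then (2 * avoid_bound S L n' + S + L + 1)%N else 0%N.

Lemma avoid_intervals (u : nat -> int) (S L n : nat) (x0 : int) : exists x : int,
  x0 <= x <= x0 + (avoid_bound S L n)%:Z /\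
  forall j, (j < n)%N -> x + L%:Z < u j \/ u j + S%:Z < x.
Proof.
elim: n x0 => [|n IH] x0; first by exists x0; split=> //=; lia.
have [x [hx ax]] := IH x0.
have [h|h] := boolP ((x + L%:Z < u n) || (u n + S%:Z < x)).
  exists x; split=> /= [|j]; first by lia.
  rewrite ltnS leq_eqVlt => /orP[/eqP ->|/ax//].
  by case/orP: h; [left|right].
have [x' [hx' ax']] := IH (x0 + (avoid_bound S L n)%:Z + S%:Z + L%:Z + 1).
exists x'; split=> /= [|j]; first by lia.
rewrite ltnS leq_eqVlt => /orP[/eqP ->|/ax'//].
by right; lia.
Qed.

Lemma many_polygons (n : nat) : exists S : nat, exists2 t : R, 0 < t &
  forall p q, even_param p q -> `|bigP R p q - P0| < t -> forall a b : int,
  exists (f : nat -> set (R * R)) (u : nat -> int),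
    (forall i, (i < n)%N -> [/\ @plaid_polygon R p q (f i), f i `<=` block p q a b &
       forall z, f i z -> (u i)%:~R <= z.1 <= (u i)%:~R + S%:R]) /\
    (forall i j, (i < n)%N -> (j < n)%N -> f i = f j -> i = j).
Proof.
elim: n => [|n [S [t t0 IH]]].
  exists 0%N; exists 1 => // p q _ _ a b; exists (fun=> set0), (fun=> 0).
  by split=> i; rewrite ltn0.
have [L [t1 t10 hL]] := vgood_dense irr P01.
(* This width leaves room for the search and for a window of length [L] that contains a good
   edge. *)
have [S2 [t2 t20 hR]] := bounded_rectangle (avoid_bound S L n + L).
exists (S + S2)%N; exists (Num.min t (Num.min t1 t2)); first by rewrite !lt_min t0 t10.
move=> p q pq; rewrite !lt_min => /and3P[ht ht1 ht2] a b.
have [f [u [hf finj]]] := IH p q pq ht a b.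
have [x [y [c [d [[hc hd] [xc yd] hv hh]]]]] := hR p q pq ht2.
pose w := (p + q)%N; pose X : int := w%:Z * (w%:Z * a); pose Y : int := w%:Z * b.
have [x1 [hx1 av]] := avoid_intervals (fun j => u j - X) S L n x%:Z.
have [m [k [hm hk mk]]] := hL p q pq ht1 x1 y%:Z.
have gs : good R p q (USeg Ver (X + m) (Y + k)) by apply/(good_vgood_shift R a b pq).
have me : square_edge (X + m) (Y + k) (USeg Ver (X + m) (Y + k)) by right; right; left.
set e := USeg Ver _ _ in gs me.
pose g := connected_component (@plaid_union R p q) (seg_mid R e).
have hg : @plaid_polygon R p q g by exact: (plaid_polygon_good gs me).
have ge : g (seg_mid R e).
  apply: connected_component_refl; exists (X + m), (Y + k), e.
  by split=> //; split=> //; exact: segment_right.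
have [hxm hmc] : x%:Z <= m /\ m <= x%:Z + c%:Z.
  by clear -hm hx1 hc; lia.
have [hyk hkd] : y%:Z <= k /\ k + 1 <= y%:Z + d%:Z.
  by clear -hk hd; lia.
have uc := uncrossed_shift a b pq hv hh.
have sub_g : g `<=` @box R (X + x%:Z) (X + (x + c)%N%:Z) (Y + y%:Z) (Y + (y + d)%N%:Z).
  apply: (plaid_polygon_confined uc hg ge); rewrite /box /seg_mid /e /=; split.
    by rewrite !ler_int; clear -hxm hmc; lia.
  have l1 : (Y + y%:Z)%:~R <= (Y + k)%:~R :> R by rewrite ler_int; clear -hyk; lia.
  have l2 : (Y + k)%:~R + 1 <= (Y + (y + d)%N%:Z)%:~R :> R.
    by rewrite -[1]/(1%:~R) -intrD ler_int; clear -hkd; lia.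
  apply/andP; split; first by apply: le_trans l1 _; rewrite lerDl invr_ge0.
  by apply: le_trans l2; rewrite lerD2l invf_le1 // ler1n.
have g_new j : (j < n)%N -> f j <> g.
  move=> jn fg; have [_ _ /(_ (seg_mid R e))] := hf j jn.
  rewrite fg => /(_ ge); rewrite /seg_mid /e /=.
  rewrite -[S%:R]/(S%:Z%:~R) -intrD !ler_int => h.
  by have := av j jn; clear -h hm; lia.
exists (fun i => if i == n then g else f i), (fun i => if i == n then X + x%:Z else u i).
split=> [i|i j].
  rewrite ltnS leq_eqVlt; case: eqVneq => [_ _|ne /= hin].
    split=> // z /sub_g[/andP[z1 z2] /andP[z3 z4]].
      rewrite block_box /box /= -/w -/X -/Y; split; apply/andP; split.
      - by apply: le_trans z1; rewrite ler_int; clear; lia.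
      - by apply: le_trans z2 _; rewrite ler_int; clear -xc; rewrite /w; lia.
      - by apply: le_trans z3; rewrite ler_int; clear; lia.
      - by apply: le_trans z4 _; rewrite ler_int; clear -yd; rewrite /w; lia.
    rewrite z1 /=; apply: le_trans z2 _.
    by rewrite -[(S + S2)%:R]/((S + S2)%N%:Z%:~R) -intrD ler_int; clear -hc; lia.
  have [h1 h2 h3] := hf i hin; split=> // z /h3/andP[-> /= /le_trans]; apply.
  by rewrite lerD2l ler_nat leq_addr.
move=> hi hj; have lt_n k' : (k' < n.+1)%N -> k' != n -> (k' < n)%N.
  by rewrite ltnS leq_eqVlt => /orP[->|].
case: eqVneq => [->|/(lt_n _ hi) {}hi]; case: eqVneq => [->|/(lt_n _ hj) {}hj].
- by move=> _.
- by move=> /esym h; case: (g_new j hj h).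
- by move=> h; case: (g_new i hi h).
- exact: finj.
Qed.

End Scales.

Theorem theorem4p1 (R : realType) (p q : nat -> nat) (alpha : R)
  (a b : nat -> int) (N : int) :
  (forall k, even_param (p k) (q k)) ->
  (forall r : rat, alpha <> ratr r) ->
  (fun k => ((p k)%:R / (q k)%:R : R)) @ \oo --> alpha ->
  exists K : nat, forall k : nat, (K <= k)%N ->
    (exists n : nat, N < n%:Z /\
       exists f : nat -> set (R * R),
         (forall i j, (i < n)%N -> (j < n)%N -> f i = f j -> i = j) /\
         (forall i, (i < n)%N ->
            @plaid_polygon R (p k) (q k) (f i) /\
            f i `<=` @block R (p k) (q k) (a k) (b k))) /\
    (exists C : set (R * R),
       @plaid_polygon R (p k) (q k) C /\ C `<=` @block R (p k) (q k) (a k) (b k) /\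
       exists z w, C z /\ C w /\ N%:~R < dist2 z w).
Proof.
move=> ev irr lim.
have near (e : R) : 0 < e -> exists K : nat, forall k, (K <= k)%N ->
    `|alpha - (p k)%:R / (q k)%:R| < e.
  move=> e0; have /cvgrPdist_lt/(_ e e0)[K _ hK] := lim.
  by exists K => k hk; exact: hK.
have ratio k : 0 < ((p k)%:R / (q k)%:R : R) < 1.
  have [p0 pq _ _] := ev k.
  have q0 : 0 < (q k)%:R :> R by rewrite ltr0n (ltn_trans p0).
  apply/andP; split; first by apply: divr_gt0 => //; rewrite ltr0n.
  by rewrite ltr_pdivrMr // mul1r ltr_nat.
have alpha_ge0 : 0 <= alpha.
  rewrite leNgt; apply/negP => neg; have [K /(_ K (leqnn K))] := near (- alpha) ltac:(lra).
  by have /andP[r0 r1] := ratio K; rewrite ltr_norml; lra.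
have alpha_le1 : alpha <= 1.
  rewrite leNgt; apply/negP => neg; have [K /(_ K (leqnn K))] := near (alpha - 1) ltac:(lra).
  by have /andP[r0 r1] := ratio K; rewrite ltr_norml; lra.
have alpha_gt0 : 0 < alpha.
  rewrite lt_neqAle alpha_ge0 andbT; apply/eqP => e; apply: (irr 0).
  by rewrite rmorph0.
have alpha_lt1 : alpha < 1.
  rewrite lt_neqAle alpha_le1 andbT; apply/eqP => e; apply: (irr 1).
  by rewrite rmorph1.
(* The limit of the slopes, as [2 p / (p + q) = 2 x / (1 + x)] for [x = p / q]. *)
pose P0 := 2 * alpha / (1 + alpha).
have a1 : 1 + alpha != 0 by rewrite gt_eqF //; lra.
have P01 : 0 < P0 < 1.
  apply/andP; split; first by apply: divr_gt0; lra.
  by rewrite /P0 ltr_pdivrMr; lra.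
have P0irr (s z : int) : s != 0 -> P0 * s%:~R <> z%:~R.
  move=> s0 h; have h2 : (2 * s - z)%:~R * alpha = z%:~R.
    by rewrite intrB intrM -h /P0; field.
  have [sz|sz] := eqVneq (2 * s - z) 0.
    move: h2; rewrite sz mul0r => /esym/eqP; rewrite intr_eq0 => /eqP z0.
    by move: s0 sz; rewrite z0; clear; lia.
  apply: (irr (z%:~R / (2 * s - z)%:~R));
  rewrite fmorph_div !rmorph_int -h2 [_ * alpha]mulrC mulfK //.
  by rewrite intr_eq0.
have close k : `|bigP R (p k) (q k) - P0| <= 2 * `|alpha - (p k)%:R / (q k)%:R|.
  have [p0 pq _ _] := ev k.
  have q0 : 0 < (q k)%:R :> R by rewrite ltr0n (ltn_trans p0).
  have q00 : (q k)%:R != 0 :> R by rewrite gt_eqF.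
  have /andP[r0 r1] := ratio k.
  have -> : bigP R (p k) (q k) = 2 * ((p k)%:R / (q k)%:R) / (1 + (p k)%:R / (q k)%:R).
    rewrite /bigP /omega natrD; field.
    by rewrite q00 /= gt_eqF // addr_gt0 // ltr0n.
  set x := _ / _ in r0 r1 *; have x1 : 1 + x != 0 by rewrite gt_eqF //; lra.
  have -> : 2 * x / (1 + x) - P0 = 2 * (x - alpha) / ((1 + x) * (1 + alpha)).
    by rewrite /P0; field; rewrite x1 a1.
  rewrite normrM normrM [`|2|]gtr0_norm // [`|x - alpha|]distrC ler_piMr //.
  have den : 1 <= (1 + x) * (1 + alpha) by nra.
  by rewrite ger0_norm ?invr_ge0 ?invf_le1 //; lra.
have [S [t1 t10 many]] := many_polygons P0irr P01 `|N|%N.+1.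
have /andP[P0gt _] := P01.
(* Once [w > M] and [P > P0 / 2], the bound [2 p = P w] exceeds [|N| + 2], more than what
   [tall_polygon] requires. *)
pose M := (Num.truncn (2 * (`|N|%N + 2)%:R / P0)).+1.
have hM : 2 * (`|N|%N + 2)%:R < P0 * M%:R.
  have /andP[_] := truncn_bounds (divr_ge0
    (mulr_ge0 (ler0n R 2) (ler0n R (`|N|%N + 2))) (ltW P0gt)).
  by rewrite natr1 -/M ltr_pdivrMr // [ltRHS]mulrC.
have [d d0 [t2 t20 away]] := away_from_int P0irr M.
pose t := Num.min (Num.min t1 t2) (P0 / 2).
have t0 : 0 < t by rewrite !lt_min t10 t20 /=; lra.
have [K hK] := near (t / 2) ltac:(lra).
exists K => k /hK hk.
have : `|bigP R (p k) (q k) - P0| < t by apply: le_lt_trans (close k) _; lra.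
rewrite !lt_min => /andP[/andP[h1 h2] h3]; split.
  exists `|N|%N.+1; split; first by clear; lia.
  have [f [u [hf finj]]] := many _ _ (ev k) h1 (a k) (b k).
  by exists f; split=> // i /hf[].
have [C [hC sub [z [v [Cz Cv hd]]]]] := tall_polygon R (a k) (b k) (ev k).
exists C; split=> //; split=> //; exists z, v; split=> //; split=> //.
apply: lt_le_trans hd.
have Pw := bigPw R (ev k).
(* The product of [P] and [w] is the integer [2 p], whereas near [P0] no positive multiplier up to
   [M] brings [P] to an integer. *)
have wM : (M < p k + q k)%N.
  rewrite ltnNge; apply/negP => wM.
  have w0 : (0 < p k + q k <= M)%N by have [p0 _ _ _] := ev k; rewrite addn_gt0 p0 wM.
  have := away _ h2 _ (2 * (p k)%:Z) w0.
  by rewrite Pw intrM -pmulrn subrr normr0; lra.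
have Pgt : P0 / 2 < bigP R (p k) (q k) by move: h3; rewrite ltr_norml; lra.
have : P0 / 2 * M%:R < 2 * (p k)%:R.
  rewrite -Pw; apply: (@lt_trans _ _ (P0 / 2 * (p k + q k)%:R)).
    by rewrite ltr_pM2l ?ltr_nat //; lra.
  by rewrite ltr_pM2r // (w_gt0 R (ev k)).
have NN : N%:~R <= `|N|%N%:R :> R by rewrite pmulrn ler_int; clear; lia.
move: hM; rewrite natrD; lra.
Qed.
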